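(* Let $D\subseteq[n]^2$ and let $\mathcal{C}=(m,\{P_k\}_{k=1}^\ell,\{p_k\}_{k=1}^\ell,\{\lambda_k\}_{k=1}^\ell)$ be a compression of $D$. For $k\in[\ell]$ let $R_k(\mathcal{C})=\{r\in[n]:(r,p_k)\in D\}\subseteq[m]$. Given as input $\{R_k(\mathcal{C})\}_{k=1}^\ell$, $\{\lambda_k\}_{k=1}^\ell$, and $\tilde\alpha=(\tilde\alpha_1,\dots,\tilde\alpha_m)\in\mathbb{Z}_{\ge0}^m$ satisfying $\tilde\alpha_1+\dots+\tilde\alpha_m=\#D$, one can decide whether $\alpha:=(\tilde\alpha_1,\dots,\tilde\alpha_m,0,\dots,0)\in\mathbb{Z}_{\ge0}^n$ lies in $\mathcal{S}_D$ in polynomial time in $m$ and $\ell$.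
   Context: A tuple $\mathcal{C}=(m,\{P_k\}_{k=1}^\ell,\{p_k\}_{k=1}^\ell,\{\lambda_k\}_{k=1}^\ell)$ is a compression of $D\subseteq[n]^2$ if: $m\le n$ is a nonnegative integer such that $(r,p)\notin D$ whenever $r>m$ and $p\in[n]$; $P_1,\dots,P_\ell$ are pairwise disjoint subsets of $[n]$ such that if $p,p'\in P_k$ then $\{r\in[n]:(r,p)\in D\}=\{r\in[n]:(r,p')\in D\}$, and such that every $p\in[n]$ for which column $p$ of $D$ is nonempty lies in some $P_k$; $p_k\in P_k$ is a representative for each $k\in[\ell]$; and $\lambda_k=\#P_k$ for each $k\in[\ell]$. Schubitope $\mathcal{S}_D$: given $S\subseteq[n]$ and a column $c\in[n]$, form a string $\mathsf{word}_{c,S}(D)$ by reading column $c$ from top to bottom ($r=1,\dots,n$) and recording ''$($'' if $(r,c)\notin D$ and $r\in S$; ''$)$'' if $(r,c)\in D$ and $r\notin S$; ''$\star$'' if $(r,c)\in D$ and $r\in S$ (and nothing otherwise). Let $\theta_D^c(S)$ be the number of $\star$'s in $\mathsf{word}_{c,S}(D)$ plus the number of matched pairs $()$ in it, using the standard inside-out matching of parentheses (ignoring $\star$'s), and let $\theta_D(S)=\sum_{c=1}^n\theta_D^c(S)$. Then $\mathcal{S}_D=\{(\alpha_1,\dots,\alpha_n)\in\mathbb{R}_{\ge0}^n:\alpha_1+\dots+\alpha_n=\#D\text{ and }\sum_{i\in S}\alpha_i\le\theta_D(S)\text{ for all }S\subseteq[n]\}$. Arithmetic operations are assumed to take constant time.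 *)

(* Defs.v *)
From HB Require Import structures.
From mathcomp Require Import all_boot all_order all_algebra.
From mathcomp Require Import all_classical all_reals.
Set Implicit Arguments.
Unset Strict Implicit.
Unset Printing Implicit Defensive.
Import Order.TTheory GRing.Theory Num.Theory.
Local Open Scope ring_scope.

(* Diagrams are sets D : {set 'I_n * 'I_n} of (row, column) pairs; rows and
   columns are numbered from 0, so the ordinal i stands for i + 1 in [n]. *)

Definition column n (D : {set 'I_n * 'I_n}) (c : 'I_n) : {set 'I_n} :=
  [set r : 'I_n | (r, c) \in D].

(* "r > m" with rows numbered from 1 is "m <= r" with rows numbered from 0. *)
Record compression n (D : {set 'I_n * 'I_n}) := Compression {
  cm : nat;
  cl : nat;
  cblock : 'I_cl -> {set 'I_n};
  crep : 'I_cl -> 'I_n;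
  cmult : 'I_cl -> nat;
  cm_le : (cm <= n)%N;
  cm_rows : forall r c : 'I_n, (cm <= r)%N -> (r, c) \notin D;
  cblock_disjoint :
    forall k k' : 'I_cl, k != k' -> [disjoint cblock k & cblock k'];
  cblock_column : forall (k : 'I_cl) (c c' : 'I_n),
    c \in cblock k -> c' \in cblock k -> column D c = column D c';
  cblock_cover : forall c : 'I_n,
    column D c != finset.set0 -> exists k : 'I_cl, c \in cblock k;
  crep_in : forall k : 'I_cl, crep k \in cblock k;
  cmultE : forall k : 'I_cl, cmult k = #|cblock k|
}.
Arguments cblock {n D} C k : rename.
Arguments crep {n D} C k : rename.
Arguments cmult {n D} C k : rename.

(* R_k as a subset of [m]; no element of column D (crep C k) is lost, by
   cm_rows. *)
Definition crows n (D : {set 'I_n * 'I_n}) (C : compression D) (k : 'I_(cl C)) :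
    {set 'I_(cm C)} :=
  [set r : 'I_(cm C) | widen_ord (cm_le C) r \in column D (crep C k)].
Arguments crows {n D} C k.

Inductive symbol := Open | Close | Star.

Definition is_star (x : symbol) : bool := if x is Star then true else false.

Definition letter n (D : {set 'I_n * 'I_n}) (S : {set 'I_n}) (c r : 'I_n) :
    option symbol :=
  match (r, c) \in D, r \in S with
  | false, true => Some Open
  | true, false => Some Close
  | true, true => Some Star
  | false, false => None
  end.

(* enum 'I_n is increasing: the column is read from top to bottom. *)
Definition word n (D : {set 'I_n * 'I_n}) (S : {set 'I_n}) (c : 'I_n) :
    seq symbol :=
  pmap (letter D S c) (enum 'I_n).

(* Inside-out matching: an adjacent "()" is matched and erased, as long as
   there is one. *)
Fixpoint erase_pair (w : seq symbol) : option (seq symbol) :=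
  match w with
  | Open :: Close :: w' => Some w'
  | x :: w' => omap (cons x) (erase_pair w')
  | [::] => None
  end.

Fixpoint matched_rec (fuel : nat) (w : seq symbol) : nat :=
  match fuel, erase_pair w with
  | fuel'.+1, Some w' => (matched_rec fuel' w').+1
  | _, _ => 0
  end.

(* Each erasure shortens the word, so size w rounds exhaust the pairs. *)
Definition matched (w : seq symbol) : nat := matched_rec (size w) w.

Definition theta_col n (D : {set 'I_n * 'I_n}) (S : {set 'I_n}) (c : 'I_n) :
    nat :=
  let w := word D S c in
  (count is_star w + matched [seq x <- w | ~~ is_star x])%N.

Definition theta n (D : {set 'I_n * 'I_n}) (S : {set 'I_n}) : nat :=
  (\sum_(c < n) theta_col D S c)%N.

Definition schubitope (R : realType) n (D : {set 'I_n * 'I_n}) :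
    set 'rV[R]_n :=
  [set a : 'rV[R]_n |
    [/\ forall i : 'I_n, 0 <= a 0 i,
        \sum_(i < n) a 0 i = #|D|%:R
      & forall S : {set 'I_n}, \sum_(i in S) a 0 i <= (theta D S)%:R]]%classic.
Arguments schubitope R {n} D.

(* (a_1, ..., a_m, 0, ..., 0), for m <= n. *)
Definition pad_zeros (R : realType) (m n : nat) (a : m.-tuple nat) : 'rV[R]_n :=
  \row_(i < n) (nth 0%N a i)%:R.
Arguments pad_zeros R {m} n a.

(* Unit-cost random access programs over the integers: every arithmetic
   operation, test and memory access takes constant time whatever the size of
   its operands.  There is no integer division, whose use at unit cost would
   make the model unreasonably powerful; exact division of rationals is
   available at constant overhead through fractions. *)

Inductive binop := Add | Sub | Mul.

Inductive expr :=
  | Const of int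
  | Var of nat
  | Read of nat & expr
  | Op of binop & expr & expr.

Inductive cmd :=
  | Skip
  | Assign of nat & expr
  | Write of nat & expr & expr
  | Seq of cmd & cmd
  | If of expr & cmd & cmd
  | While of expr & cmd.

(* vars s x is the content of the variable x, and arrs s a i is the content of
   the cell of index i of the array a. *)
Record state := State { vars : nat -> int; arrs : nat -> int -> int }.

Definition eval_binop (o : binop) (x y : int) : int :=
  match o with Add => x + y | Sub => x - y | Mul => x * y end.

Fixpoint eval (s : state) (e : expr) : int :=
  match e with
  | Const z => z
  | Var x => vars s x
  | Read a e1 => arrs s a (eval s e1)
  | Op o e1 e2 => eval_binop o (eval s e1) (eval s e2)
  end.

Fixpoint cost (e : expr) : nat :=
  match e with
  | Const _ | Var _ => 1
  | Read _ e1 => (cost e1).+1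
  | Op _ e1 e2 => (cost e1 + cost e2).+1
  end.

Definition set_var (s : state) (x : nat) (v : int) : state :=
  State (fun y => if y == x then v else vars s y) (arrs s).

Definition set_cell (s : state) (a : nat) (i v : int) : state :=
  State (vars s)
    (fun b j => if (b == a) && (j == i) then v else arrs s b j).

(* exec c s t s' : started in s, the program c halts in s' after t steps.
   Tests are for positivity. *)
Inductive exec : cmd -> state -> nat -> state -> Prop :=
  | ExecSkip s : exec Skip s 1 s
  | ExecAssign x e s :
      exec (Assign x e) s (cost e).+1 (set_var s x (eval s e))
  | ExecWrite a e1 e2 s :
      exec (Write a e1 e2) s (cost e1 + cost e2).+1
        (set_cell s a (eval s e1) (eval s e2))
  | ExecSeq c1 c2 s1 s2 s3 t1 t2 :
      exec c1 s1 t1 s2 -> exec c2 s2 t2 s3 ->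
      exec (Seq c1 c2) s1 (t1 + t2) s3
  | ExecIfTrue e c1 c2 s s' t :
      0 < eval s e -> exec c1 s t s' ->
      exec (If e c1 c2) s (cost e + t).+1 s'
  | ExecIfFalse e c1 c2 s s' t :
      eval s e <= 0 -> exec c2 s t s' ->
      exec (If e c1 c2) s (cost e + t).+1 s'
  | ExecWhileTrue e c s1 s2 s3 t1 t2 :
      0 < eval s1 e -> exec c s1 t1 s2 -> exec (While e c) s2 t2 s3 ->
      exec (While e c) s1 (cost e + t1 + t2).+1 s3
  | ExecWhileFalse e c s :
      eval s e <= 0 -> exec (While e c) s (cost e).+1 s.

Definition cells (s : seq nat) (i : int) : int :=
  if i is Posz j then (nth 0%N s j)%:Z else 0.

(* Input: m in variable 0, l in variable 1, the a_i in array 0, the lam_k in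
   array 1 and, in array 2, the l x m membership matrix of the sets R_k, row
   by row (r \in R_k is in cell k * m + r).  All the rest is 0. *)
Definition encode (m l : nat) (Rk : 'I_l -> {set 'I_m}) (lam : 'I_l -> nat)
    (a : m.-tuple nat) : state :=
  State
    (fun x => match x with 0 => m%:Z | 1 => l%:Z | _ => 0 end)
    (fun b => match b with
      | 0 => cells a
      | 1 => cells [seq lam k | k <- enum 'I_l]
      | 2 => cells [seq nat_of_bool (r \in Rk k) | k <- enum 'I_l, r <- enum 'I_m]
      | _ => fun=> 0
      end).

(* The answer is returned in variable 0: 1 for yes, 0 for no. *)
Definition answers (s : state) (P : Prop) : Prop :=
  vars s 0 = (nat_of_bool `[< P >])%:Z.

(* Main.v *)
(* For a column [c] with row set [R_c], the number [theta_c S] is the minimum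
   over [t] of #{r in S, r < t} + #{r in R_c, r >= t}: a duality between
   matching parentheses and cutting the word at a position [t].  Hence
   "a(S) <= theta(S) for all S" is exactly the cut condition of a flow network
   in which row [i] supplies [a_i] units, may send [lam_k] of them to the node
   [(k, i)] of block [k], node [(k, i)] consumes [lam_k] units if [i] is in
   [R_k] and forwards the rest to [(k, i + 1)] without restriction.  The
   network has (l + 1) m nodes, and push-relabel decides its cut condition in
   a number of arithmetic operations that is polynomial in the number of nodes,
   whatever the size of the capacities.  It stops with all excesses routed, or
   with an excess at a label that no node can reach by residual arcs, and then
   a gap in the labels is a violated cut. *)
From mathcomp Require Import all_boot all_order all_algebra.
From mathcomp Require Import all_classical all_reals.
From mathcomp Require Import zify ring.
Require Import Defs.
Set Implicit Arguments.
Unset Strict Implicit.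
Unset Printing Implicit Defensive.
Import Order.TTheory GRing.Theory Num.Theory.
Local Open Scope ring_scope.

(** * Push-relabel on a dense network *)

Record preflow := Preflow {
  ex : nat -> int;
  lab : nat -> nat;
  res : nat -> nat -> int
}.

Definition push (g : preflow) (a b : nat) (d : int) : preflow :=
  Preflow
    (fun w => ex g w - d *+ (w == a) + d *+ (w == b))
    (lab g)
    (fun w z => res g w z - d *+ ((w == a) && (z == b))
                          + d *+ ((w == b) && (z == a))).

Definition relabel (g : preflow) (a : nat) : preflow :=
  Preflow (ex g) (fun w => lab g w + (w == a))%N (res g).

(* Positive iff [X] violates the cut condition; no push changes it, so it can be
   read off the final preflow. *)
Definition net_supply (N : nat) (g : preflow) (X : pred nat) : int :=
  \sum_(u < N | X u) (ex g u - \sum_(v < N | ~~ X v) res g u v).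

Definition valid (N : nat) (g : preflow) : Prop :=
  [/\ forall u v, (u < N)%N -> (v < N)%N -> 0 <= res g u v,
      forall u v, (u < N)%N -> (v < N)%N -> 0 < res g u v ->
        (lab g u <= (lab g v).+1)%N,
      forall u, (u < N)%N -> ex g u < 0 -> lab g u = 0%N
    & forall u, (u < N)%N -> (lab g u <= N)%N].

Definition downhill (g : preflow) (u v : nat) : bool :=
  (0 < res g u v) && (lab g v < lab g u)%N.

Definition active (N : nat) (g : preflow) (u : nat) : bool :=
  (0 < ex g u) && (lab g u < N)%N.

(* A saturating push along an arc must be followed by two relabelings of its
   ends before the next one, which [arc_potential] accounts for; it outweighs
   the label [<= N] that the push may add to [node_potential].  A nonsaturating
   push moves all the excess to a lower label. *)
Definition arc_potential (N : nat) (g : preflow) (u v : nat) : nat :=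
  ((N - lab g u) + (N - lab g v) + downhill g u v)%N.

Definition node_potential (N : nat) (g : preflow) (u : nat) : nat :=
  (2 * (N - lab g u) + (0 < ex g u)%R * lab g u)%N.

Definition potential (N : nat) (g : preflow) : nat :=
  (N.+1 * (\sum_(u < N) \sum_(v < N) arc_potential N g u v)
   + \sum_(u < N) node_potential N g u)%N.

Lemma sum_indic (N a : nat) (P : pred nat) (d : int) : (a < N)%N ->
  \sum_(w < N | P w) d *+ (val w == a) = d *+ P a.
Proof.
move=> aN; rewrite (big_mkcond) /= (bigD1 (Ordinal aN)) //= eqxx.
rewrite big1 ?addr0; first by case: (P a); rewrite ?mulr1n ?mulr0n.
move=> i; rewrite -val_eqE /= => /negbTE->; rewrite mulr0n.
by case: ifP.
Qed.

(** If the arc leaves [X], the excess inside [X] and the residual capacity leaving [X] both fall by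
    [d]. If it enters [X], both rise by [d], because the reverse arc gains [d]. *)
Lemma net_supply_push (N : nat) (g : preflow) (a b : nat) (d : int) (X : pred nat) :
  (a < N)%N -> (b < N)%N ->
  net_supply N (push g a b d) X = net_supply N g X.
Proof.
move=> aN bN; rewrite /net_supply /=.
have H a' b' : (a' < N)%N -> (b' < N)%N ->
   \sum_(u < N | X u) \sum_(v < N | ~~ X v) d *+ ((val u == a') && (val v == b'))
   = d *+ (X a' && ~~ X b').
  move=> aN' bN'.
  under eq_bigr do under eq_bigr do rewrite andbC -mulnb mulrnA.
  under eq_bigr do rewrite sumrMnl (sum_indic (fun v => ~~ X v)) //.
  by rewrite sum_indic // -mulrnA mulnb andbC.
under eq_bigr do rewrite big_split /= sumrB.
rewrite !big_split !sumrN /=.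
rewrite !sum_indic // big_split sumrB /= !H //.
by case: (X a); case: (X b); rewrite /= ?mulr1n ?mulr0n; ring.
Qed.

Lemma ltn_sum_at (I : finType) (F G : I -> nat) (i : I) :
  (forall j, F j <= G j)%N -> (F i < G i)%N ->
  (\sum_j F j < \sum_j G j)%N.
Proof.
move=> le lt; rewrite (bigD1 i) // [X in (_ < X)%N](bigD1 i) //=.
by rewrite -addSn leq_add // leq_sum.
Qed.

(** Reduces a comparison of sums to a pointwise one in which node [a] has to drop by [x] and node
    [b] may rise by [y]. *)
Lemma leq_sum_shift (N a b x y : nat) (F G : nat -> nat) :
  (a < N)%N -> (b < N)%N ->
  (forall w, (w < N)%N -> F w + (w == a) * x <= G w + (w == b) * y)%N ->
  (\sum_(w < N) F w + x <= \sum_(w < N) G w + y)%N.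
Proof.
move=> aN bN H.
have E c z : (c < N)%N -> (\sum_(w < N) (val w == c) * z = z)%N.
  move=> cN; rewrite (bigD1 (Ordinal cN)) //= eqxx mul1n big1 ?addn0 //.
  by move=> i; rewrite -val_eqE /= => /negbTE->.
rewrite -{1}(E a x aN) -(E b y bN) -!big_split /=.
by apply: leq_sum => i _; apply: H.
Qed.

Lemma valid_push (N : nat) (g : preflow) (a b : nat) (d : int) :
  (a < N)%N -> (b < N)%N -> valid N g ->
  (lab g b < lab g a)%N -> 0 <= d -> d <= ex g a -> d <= res g a b ->
  valid N (push g a b d).
Proof.
move=> aN bN [res_ge0 lab_le deficit lab_N] lt_ba d_ge0 d_ex d_res.
have ne_ab : (b == a) = false by apply/eqP => E; rewrite E ltnn in lt_ba.
split=> /=.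
- move=> u v uN vN; have := res_ge0 u v uN vN.
  have [->|ua] := eqVneq u a; have [->|vb] := eqVneq v b;
    rewrite /= ?[b == a]ne_ab ?[a == b]eq_sym ?ne_ab /= => H; lia.
- move=> u v uN vN.
  have := lab_le u v uN vN.
  (* The only arc that can become residual is the reverse one, and it goes uphill. *)
  case: (boolP ((u == b) && (v == a))) => [/andP[/eqP-> /eqP->] _ _|_]; first lia.
  by case: (_ && _) => H ?; apply: H; lia.
- move=> u uN; have := deficit u uN; have [->|ua] := eqVneq u a.
    by rewrite eq_sym ne_ab /=; lia.
  by case: (_ == b) => H ?; apply: H; lia.
- exact: lab_N.
Qed.

Lemma potential_push (N : nat) (g : preflow) (a b : nat) (d : int) :
  (a < N)%N -> (b < N)%N -> valid N g -> downhill g a b -> 0 < d ->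
  d <= ex g a -> d = ex g a \/ d = res g a b ->
  (potential N (push g a b d) < potential N g)%N.
Proof.
move=> aN bN [res_ge0 lab_le deficit lab_N] /andP[rab lt_ba] d_gt0 d_ex d_eq.
have ne_ab : (b == a) = false by apply/eqP => E; rewrite E ltnn in lt_ba.
have ne_ba : (a == b) = false by rewrite eq_sym.
have labE : lab g a = (lab g b).+1.
  by apply/eqP; rewrite eqn_leq lt_ba lab_le.
(* Labels are fixed and only [(b, a)] gains capacity. It runs uphill, so no arc becomes downhill. *)
have arcs u v : (arc_potential N (push g a b d) u v <= arc_potential N g u v)%N.
  rewrite /arc_potential /downhill /= leq_add2l.
  have [->|ua] := eqVneq u a; rewrite ?ne_ba /=.
    by case: eqVneq => [->|_] /=; [rewrite rab lt_ba; case: (_ && _) | rewrite subr0 addr0].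
  have [->|ub] := eqVneq u b; rewrite /= ?subr0 ?addr0 //.
  have [->|va] := eqVneq v a; rewrite /= ?subr0 ?addr0 //.
  by rewrite [(_ < lab g b)%N]ltnNge (ltnW lt_ba) !andbF.
rewrite /potential.
(* A push that both empties [a] and saturates the arc is treated as emptying. In the other case
   [(a, b)] stops being downhill, a gain of [N.+1] against a loss of at most [lab g b <= N]. *)
have [dE|dE] := eqVneq d (ex g a); last first.
  have {d_eq}dE : d = res g a b by case: d_eq => // E; rewrite E eqxx in dE.
  have sumA : (\sum_(u < N) \sum_(v < N) arc_potential N (push g a b d) u v
              < \sum_(u < N) \sum_(v < N) arc_potential N g u v)%N.
    apply: (@ltn_sum_at _ _ _ (Ordinal aN)) => [j|]; first by apply: leq_sum.
    apply: (@ltn_sum_at _ _ _ (Ordinal bN)) => [j|] //=.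
    rewrite /arc_potential /downhill /= !eqxx ne_ba /= rab lt_ba dE.
    by rewrite mulr1n mulr0n subrr addr0 /= ltn_add2l.
  have sumB : (\sum_(u < N) node_potential N (push g a b d) u + 0
       <= \sum_(u < N) node_potential N g u + lab g b)%N.
    apply: (leq_sum_shift aN bN) => w wN; rewrite muln0 addn0 /node_potential /=.
    rewrite -addnA leq_add2l.
    have [->|wa] := eqVneq w a; rewrite ?ne_ba /=.
      by case: ltP; case: ltP; lia.
    by case: eqVneq => [->|_] /=; case: ltP; case: ltP; lia.
  have := lab_N _ bN.
  by nia.
have sumA : (\sum_(u < N) \sum_(v < N) arc_potential N (push g a b d) u v
              <= \sum_(u < N) \sum_(v < N) arc_potential N g u v)%N.
  by apply: leq_sum => u _; apply: leq_sum => v _.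
(* Node [a] loses its excess and hence its term [lab g a], while [b] gains at most [lab g b], which
   is one less. *)
have sumB : (\sum_(u < N) node_potential N (push g a b d) u + lab g a
       <= \sum_(u < N) node_potential N g u + lab g b)%N.
  apply: (leq_sum_shift aN bN) => w wN.
  rewrite /node_potential /= -!addnA leq_add2l.
  have [->|wa] := eqVneq w a; rewrite ?ne_ba /=.
    by case: ltP; case: ltP; lia.
  by case: eqVneq => [->|_] /=; case: ltP; case: ltP; lia.
by nia.
Qed.

Lemma valid_relabel (N : nat) (g : preflow) (a : nat) :
  (a < N)%N -> valid N g -> active N g a ->
  (forall v, (v < N)%N -> ~~ downhill g a v) ->
  valid N (relabel g a).
Proof.
move=> aN [res_ge0 lab_le deficit lab_N] /andP[exa laba] stuck; split=> //=.
- move=> u v uN vN uv; have := lab_le u v uN vN uv.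
  (* A residual arc out of [a] is not downhill, so its head is at least as high as [a] and the label
     of [a] can grow by one. *)
  have [Eu|ua] := eqVneq u a; last lia.
  by have := stuck v vN; rewrite /downhill -Eu uv /=; lia.
- move=> u uN; have := deficit u uN.
  have [->|ua] := eqVneq u a; last lia.
  by lia.
- move=> u uN; have := lab_N u uN.
  have [->|ua] := eqVneq u a; lia.
Qed.

(** Each arc at [a] gains at most one by becoming downhill and loses at least one through
    [N - lab g a]. The factor 2 in [node_potential] outweighs the unit that the excess term
    gains. *)
Lemma potential_relabel (N : nat) (g : preflow) (a : nat) :
  (a < N)%N -> active N g a ->
  (potential N (relabel g a) < potential N g)%N.
Proof.
move=> aN /andP[exa laba]; rewrite /potential -addnS leq_add //.
  rewrite leq_mul2l /=; apply: leq_sum => u _; apply: leq_sum => v _.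
  rewrite /arc_potential /downhill /=.
  have [->|ua] := eqVneq (val u) a; have [->|va] := eqVneq (val v) a;
    case: (0 < _) => /=; lia.
apply: (@ltn_sum_at _ _ _ (Ordinal aN)) => [j|]; rewrite /node_potential /=.
  have [->|ua] := eqVneq (val j) a; first by rewrite exa /=; lia.
  by rewrite addn0.
by rewrite eqxx exa /=; lia.
Qed.

(** Pigeonhole: if all labels below [N] occurred, a choice of preimages would be an injection of
    ['I_N] into itself, hence onto, and would reach [u], whose label is [N]. *)
Lemma missing_label (N : nat) (h : nat -> nat) (u : nat) :
  (u < N)%N -> h u = N -> exists2 j, (j < N)%N & forall v, (v < N)%N -> h v <> j.
Proof.
move=> uN hu.
have [/existsP[j /forallP Hj]|] := boolP [exists j : 'I_N, [forall v : 'I_N, h v != j]].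
  by exists j => // v vN; apply/eqP; apply: (Hj (Ordinal vN)).
rewrite negb_exists => /forallP H.
have {}H (j : 'I_N) : exists v : 'I_N, h v == j.
  by have := H j; rewrite negb_forall => /existsP[v]; rewrite negbK; exists v.
pose f (j : 'I_N) : 'I_N := xchoose (H j).
have fK j : h (f j) = j by apply/eqP; apply: (xchooseP (H j)).
have f_inj : injective f by move=> j k E; apply/val_inj; rewrite /= -(fK j) -(fK k) E.
have [f' _ f'K] := injF_bij f_inj.
have := fK (f' (Ordinal uN)); rewrite f'K /= hu => E.
by have := ltn_ord (f' (Ordinal uN)); rewrite -E ltnn.
Qed.

(* A node with excess and label [N] forces a gap in the labels below [N]; no
   residual arc leaves the set of nodes above the gap. *)
Lemma stalled_preflowP (N : nat) (g : preflow) :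
  valid N g -> (forall u, (u < N)%N -> ~~ active N g u) ->
  (forall X, net_supply N g X <= 0) <-> (forall u, (u < N)%N -> ex g u <= 0).
Proof.
move=> [res_ge0 lab_le deficit lab_N] stalled; split; last first.
  move=> ex_le0 X; apply: sumr_le0 => u _.
  rewrite subr_le0 (le_trans (ex_le0 u (ltn_ord u))) // sumr_ge0 // => v _.
  exact: res_ge0.
move=> cut u uN; rewrite leNgt; apply/negP => exu.
have labu : lab g u = N.
  apply/eqP; rewrite eqn_leq lab_N // leqNgt.
  by have := stalled u uN; rewrite /active exu.
have [j jN gap] := missing_label uN labu.
suff : 0 < net_supply N g (fun w => j < lab g w)%N by rewrite ltNge cut.
have term w : (w < N)%N -> (j < lab g w)%N ->
    ex g w - \sum_(v < N | ~~ (j < lab g v)%N) res g w v = ex g w.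
  move=> wN jw; rewrite big1 ?subr0 // => v; rewrite -leqNgt => vj.
  apply/eqP; rewrite eq_le res_ge0 // andbT leNgt; apply/negP => /(lab_le _ _ wN (ltn_ord v)) le.
  by have := gap v (ltn_ord v); lia.
rewrite /net_supply (bigD1 (Ordinal uN)) ?labu //= term ?labu // ltr_pwDl //.
(* Nodes with a deficit have label zero, so none of them lies above the gap. *)
apply: sumr_ge0 => w /andP[jw _]; rewrite term // leNgt; apply/negP => /deficit.
by move=> /(_ (ltn_ord w)) E; rewrite E in jw.
Qed.

(** * Matched parentheses and cuts of a word *)

Local Open Scope nat_scope.

Definition is_open (x : symbol) : bool := if x is Open then true else false.
Definition is_close (x : symbol) : bool := if x is Close then true else false.

Lemma erase_pair_Some (w w' : seq symbol) : erase_pair w = Some w' ->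
  exists p q, w = p ++ [:: Open, Close & q] /\ w' = p ++ q.
Proof.
elim: w w' => [|x w IHw] w' //=.
have aux : omap (cons x) (erase_pair w) = Some w' ->
    exists p q, x :: w = p ++ [:: Open, Close & q] /\ w' = p ++ q.
  case E: (erase_pair w) => [v|] //= [<-].
  by have [p [q [-> ->]]] := IHw _ E; exists (x :: p), q.
case: x aux => [||] aux //; case: w IHw aux => [|[||] w] IHw aux //.
by move=> [<-]; exists [::], w.
Qed.

(** Without stars and without an adjacent pair, no closing parenthesis follows an opening one: the
    word is a run of [Close] and then a run of [Open]. *)
Lemma erase_pair_None (w : seq symbol) : erase_pair w = None -> all (predC is_star) w ->
  exists x y, [/\ w = x ++ y, count is_open x = 0 & count is_close y = 0].
Proof.
elim: w => [|x w IHw] //=; first by exists [::], [::].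
move=> E /andP[nx nw].
have E' : erase_pair w = None.
  have omapN (f : seq symbol -> seq symbol) o : omap f o = None -> o = None by case: o.
  by case: x E {nx} => [||]; case: w {IHw nw} => [|[||] w] // /omapN.
have [p [q [Ew op cl]]] := IHw E' nw.
case: x nx E => [||] //= _.
  case: p Ew op => [|y p] /= Ew op.
    by exists [::], (Open :: q); rewrite -Ew /= in cl *; split.
  by move: nw op; rewrite Ew; case: (y).
by exists (Close :: p), q; rewrite Ew.
Qed.

Lemma dropl_cat (T : Type) (x y : seq T) i : i <= size x ->
  drop i (x ++ y) = drop i x ++ y.
Proof.
by rewrite drop_cat; case: ltngtP => // -> _; rewrite subnn drop0 drop_size.
Qed.

(** Weak duality: a matched pair has its [Open] in [x] or its [Close] in [y]. The erased pair lies
    in [y], in [x] or across the cut, and in each case its removal lowers the bound by at least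
    one. *)
Lemma matched_rec_le (fuel : nat) (x y : seq symbol) :
  matched_rec fuel (x ++ y) <= count is_open x + count is_close y.
Proof.
elim: fuel x y => [|fuel IH] x y //=.
case E: (erase_pair _) => [w'|] //.
have [p [q [Ew ->]]] := erase_pair_Some E.
have [le_xp|lt_px] := leqP (size x) (size p).
  have Ep : p = x ++ drop (size x) p.
    rewrite -{1}(cat_take_drop (size x) p); congr (_ ++ _).
    by have := congr1 (take (size x)) Ew; rewrite take_size_cat // takel_cat.
  have Ey : y = drop (size x) p ++ [:: Open, Close & q].
    by have := congr1 (drop (size x)) Ew; rewrite drop_size_cat // dropl_cat.
  rewrite Ep -catA; have := IH x (drop (size x) p ++ q).
  by rewrite Ey !count_cat /=; lia.
have Ex : exists2 z, x = p ++ Open :: z & Close :: q = z ++ y.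
  exists (drop (size p).+1 x).
    rewrite -{1}(cat_take_drop (size p) x); congr (_ ++ _).
      by have := congr1 (take (size p)) Ew; rewrite takel_cat 1?ltnW // take_size_cat.
    have := congr1 (drop (size p)) Ew; rewrite drop_cat lt_px drop_size_cat //.
    by rewrite (drop_nth Open) // => -[-> _].
  have := congr1 (drop (size p).+1) Ew; by rewrite dropl_cat // drop_cat ltnNge leqnSn subSnn.
case: Ex => -[|b z] -> /=.
  move=> E2; have := IH p q; rewrite -E2 count_cat /=; lia.
case=> <- Eq; rewrite Eq catA; have := IH (p ++ z) y.
by rewrite !count_cat /=; lia.
Qed.

(** Strong duality: the fully reduced word has a cut of value zero. Each erasure is then undone by
    putting the pair back on one side of the cut, where it adds exactly one. *)
Lemma matched_rec_ge (fuel : nat) (w : seq symbol) : size w <= fuel ->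
  all (predC is_star) w ->
  exists x y, w = x ++ y /\ count is_open x + count is_close y <= matched_rec fuel w.
Proof.
elim: fuel w => [|fuel IH] w; first by case: w => // _ _; exists [::], [::].
move=> sw nw /=; case E: (erase_pair w) => [w'|]; last first.
  by have [x [y [Ew op cl]]] := erase_pair_None E nw; exists x, y; rewrite op cl.
have [p [q [Ew Ew']]] := erase_pair_Some E.
have sw' : size w' <= fuel by move: sw; rewrite Ew Ew' !size_cat /=; lia.
have nw' : all (predC is_star) w' by move: nw; rewrite Ew Ew' !all_cat /=.
have [x [y [Exy le]]] := IH w' sw' nw'.
have [le_xp|lt_px] := leqP (size x) (size p).
  exists x, (drop (size x) p ++ [:: Open, Close & q]).
  have Ex : x = take (size x) p.
    by rewrite -(takel_cat q le_xp) -Ew' Exy take_size_cat.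
  have Ey : y = drop (size x) p ++ q.
    have := congr1 (drop (size x)) Exy; rewrite drop_size_cat // Ew' dropl_cat // => <-.
  split; first by rewrite {1}Ex catA cat_take_drop.
  by move: le; rewrite Ey !count_cat /=; lia.
exists (p ++ [:: Open, Close & drop (size p) x]), y.
have Ep : p = take (size p) x.
  by rewrite -(takel_cat y (ltnW lt_px)) -Exy Ew' take_size_cat.
have Eq : q = drop (size p) x ++ y.
  by have := congr1 (drop (size p)) Exy; rewrite Ew' drop_cat ltnn subnn drop0 drop_cat lt_px.
split; first by rewrite Ew -catA /= Eq.
by move: le; rewrite -{1}(cat_take_drop (size p) x) -Ep !count_cat /=; lia.
Qed.

Lemma pmap_cat_inv (T U : Type) (f : T -> option U) (s : seq T) (x y : seq U) :
  pmap f s = x ++ y -> exists s1 s2, [/\ s = s1 ++ s2, pmap f s1 = x & pmap f s2 = y].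
Proof.
elim: s x => [|z s IHs] x /=.
  by case: x y => [|? ?] [|? ?] // _; exists [::], [::].
case fz: (f z) => [u|] /=; last first.
  by move=> /IHs[s1 [s2 [-> <- <-]]]; exists (z :: s1), s2; rewrite /= fz.
case: x => [|v x] /=.
  by move=> E; exists [::], (z :: s); rewrite /= fz.
by move=> [<- /IHs[s1 [s2 [-> <- <-]]]]; exists (z :: s1), s2; rewrite /= fz.
Qed.

(** A row of [S] is an [Open] or a [Star], a row of the column is a [Close] or a [Star]. The stars
    of [s1] complete the first count and those of [s2] the second. *)
Lemma count_letters n (D : {set 'I_n * 'I_n}) (S : {set 'I_n}) (c : 'I_n)
    (s1 s2 : seq 'I_n) :
  count is_star (pmap (letter D S c) (s1 ++ s2))
  + (count is_open [seq x <- pmap (letter D S c) s1 | ~~ is_star x]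
     + count is_close [seq x <- pmap (letter D S c) s2 | ~~ is_star x])
  = count [in S] s1 + count [in column D c] s2.
Proof.
have stars s : count is_open [seq x <- pmap (letter D S c) s | ~~ is_star x]
    + count is_star (pmap (letter D S c) s) = count [in S] s.
  elim: s => //= r s <-; rewrite /letter.
  by case: (_ \in D); case: (r \in S) => /=; rewrite ?addnS ?addSn.
have stars' s : count is_close [seq x <- pmap (letter D S c) s | ~~ is_star x]
    + count is_star (pmap (letter D S c) s) = count [in column D c] s.
  elim: s => //= r s <-; rewrite /letter inE.
  by case: (_ \in D); case: (r \in S) => /=; rewrite ?addnS ?addSn.
by rewrite pmap_cat count_cat -stars -stars'; lia.
Qed.

Lemma theta_col_le n (D : {set 'I_n * 'I_n}) (S : {set 'I_n}) (c : 'I_n)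
    (s1 s2 : seq 'I_n) : enum 'I_n = s1 ++ s2 ->
  theta_col D S c <= count [in S] s1 + count [in column D c] s2.
Proof.
move=> E; rewrite -count_letters /theta_col /word E leq_add2l /matched pmap_cat filter_cat.
exact: matched_rec_le.
Qed.

Lemma theta_col_ge n (D : {set 'I_n * 'I_n}) (S : {set 'I_n}) (c : 'I_n) :
  exists s1 s2, enum 'I_n = s1 ++ s2 /\
  count [in S] s1 + count [in column D c] s2 <= theta_col D S c.
Proof.
set w := [seq x <- word D S c | ~~ is_star x].
have nw : all (predC is_star) w by apply: filter_all.
have [x [y [Ew le]]] := matched_rec_ge (leqnn (size w)) nw.
(* The word without stars is written as one partial map of the rows, so that a cut of the word pulls
   back to a cut of the rows. *)
have wE : w = pmap (obind (fun x => if is_star x then None else Some x) \o letter D S c)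
    (enum 'I_n).
  rewrite /w /word; elim: (enum 'I_n) => //= r s IHs.
  by case: (letter D S c r) => [[||]|] //=; rewrite IHs.
have [s1 [s2 [E E1 E2]]] := pmap_cat_inv (etrans (esym wE) Ew).
exists s1, s2; split=> //; rewrite -count_letters -E leq_add2l.
apply: leq_trans le; apply: eq_leq.
have fE s : [seq x <- pmap (letter D S c) s | ~~ is_star x] =
   pmap (obind (fun x => if is_star x then None else Some x) \o letter D S c) s.
  elim: s => //= r s IHs.
  by case: (letter D S c r) => [[||]|] //=; rewrite IHs.
by rewrite !fE E1 E2.
Qed.

Lemma count_take_enum n (P : pred 'I_n) t :
  count P (take t (enum 'I_n)) = \sum_(i < n | i < t) P i.
Proof.
have -> : take t (enum 'I_n) = [seq i : 'I_n <- enum 'I_n | i < t].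
  apply: (inj_map val_inj); rewrite map_take val_enum_ord.
  transitivity [seq i <- iota 0 n | i < t]; last by rewrite -val_enum_ord filter_map.
  have [le|lt] := leqP t n.
    by rewrite take_iota (minn_idPl le); have := filter_iota_ltn 0 le; rewrite add0n => ->.
  rewrite take_oversize ?size_iota; last exact: ltnW.
  apply/esym/all_filterP/allP => i.
  by rewrite mem_iota add0n => /andP[_ /ltn_trans]; apply.
rewrite -sum1_count big_filter_cond big_enum_cond /= big_mkcondr /=.
by apply: eq_bigr => i _; case: (P i).
Qed.

Lemma count_drop_enum n (P : pred 'I_n) t :
  count P (drop t (enum 'I_n)) = \sum_(i < n | t <= i) P i.
Proof.
apply/(@addnI (count P (take t (enum 'I_n)))); rewrite -count_cat cat_take_drop.
rewrite count_take_enum -sum1_count big_enum_cond /= big_mkcond /=.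
transitivity (\sum_(i < n) (P i : nat)); first by apply: eq_bigr => i _; case: (P i).
rewrite (bigID (fun i : 'I_n => i < t)) /=; congr (_ + _).
by apply: eq_bigl => i; rewrite -leqNgt.
Qed.

(* [t] ranges over the cut positions of the column: matching parentheses is
   dual to cutting the word. *)
Lemma theta_col_le_cut n (D : {set 'I_n * 'I_n}) (S : {set 'I_n}) (c : 'I_n) t :
  theta_col D S c <=
    \sum_(i < n | i < t) (i \in S) + \sum_(i < n | t <= i) ((i, c) \in D).
Proof.
have := theta_col_le D S c (esym (cat_take_drop t (enum 'I_n))).
rewrite count_take_enum count_drop_enum.
by under [X in _ <= _ + X -> _]eq_bigr do rewrite inE.
Qed.

Lemma theta_col_ge_cut n (D : {set 'I_n * 'I_n}) (S : {set 'I_n}) (c : 'I_n) :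
  exists t, \sum_(i < n | i < t) (i \in S) + \sum_(i < n | t <= i) ((i, c) \in D)
    <= theta_col D S c.
Proof.
have [s1 [s2 [E le]]] := theta_col_ge D S c; exists (size s1).
apply: leq_trans le; apply: eq_leq.
rewrite -[in RHS](take_size_cat s2 (erefl (size s1))) -E count_take_enum.
rewrite -[in RHS](drop_size_cat s2 (erefl (size s1))) -E count_drop_enum.
by congr addn; apply: eq_bigr => i _; rewrite inE.
Qed.

Local Open Scope ring_scope.

(** * Programs *)

(** Total correctness within a time budget. As [T] is only an upper bound, executions of different
    lengths can share it. *)
Definition wp (c : cmd) (T : nat) (Q : state -> Prop) (s : state) : Prop :=
  exists t s', [/\ exec c s t s', (t <= T)%N & Q s'].

Lemma wp_mono c T T' (Q Q' : state -> Prop) s : (T <= T')%N ->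
  (forall s', Q s' -> Q' s') -> wp c T Q s -> wp c T' Q' s.
Proof.
by move=> leT sub [t [s' [ex le q]]]; exists t, s'; split; [|exact: leq_trans leT|exact: sub].
Qed.

Lemma wp_seq c1 c2 T1 T2 Q s :
  wp c1 T1 (wp c2 T2 Q) s -> wp (Seq c1 c2) (T1 + T2) Q s.
Proof.
move=> [t1 [s1 [ex1 le1 [t2 [s2 [ex2 le2 q]]]]]].
by exists (t1 + t2)%N, s2; split=> //; [exact: ExecSeq ex1 ex2 | exact: leq_add].
Qed.

(** The budgets of the branches are added rather than maximized, which keeps running times
    polynomial expressions. *)
Lemma wp_if e c1 c2 T1 T2 Q s :
  (0 < eval s e -> wp c1 T1 Q s) -> (eval s e <= 0 -> wp c2 T2 Q s) ->
  wp (If e c1 c2) (cost e + (T1 + T2)).+1 Q s.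
Proof.
move=> H1 H2; case: (ltP 0 (eval s e)) => [pos|neg].
  have [t [s' [ex le q]]] := H1 pos; exists (cost e + t).+1, s'.
  by split=> //; [exact: ExecIfTrue | lia].
have [t [s' [ex le q]]] := H2 neg; exists (cost e + t).+1, s'.
by split=> //; [exact: ExecIfFalse | lia].
Qed.

Lemma wp_skip (Q : state -> Prop) s : Q s -> wp Skip 1 Q s.
Proof. by move=> q; exists 1%N, s; split=> //; exact: ExecSkip. Qed.

Lemma wp_assign x e (Q : state -> Prop) s :
  Q (set_var s x (eval s e)) -> wp (Assign x e) (cost e).+1 Q s.
Proof. by move=> q; eexists _, _; split; [exact: ExecAssign| |]. Qed.

(* Loop-free programs are interpreted by computation; on loops [run] is junk. *)
Fixpoint run (c : cmd) (s : state) : state :=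
  match c with
  | Skip | While _ _ => s
  | Assign x e => set_var s x (eval s e)
  | Write a e1 e2 => set_cell s a (eval s e1) (eval s e2)
  | Seq c1 c2 => run c2 (run c1 s)
  | If e c1 c2 => if 0 < eval s e then run c1 s else run c2 s
  end.

Fixpoint run_time (c : cmd) : nat :=
  match c with
  | Skip | While _ _ => 1
  | Assign x e => (cost e).+1
  | Write a e1 e2 => (cost e1 + cost e2).+1
  | Seq c1 c2 => run_time c1 + run_time c2
  | If e c1 c2 => (cost e + (run_time c1 + run_time c2)).+1
  end.

Fixpoint loop_free (c : cmd) : bool :=
  match c with
  | While _ _ => false
  | Seq c1 c2 | If _ c1 c2 => loop_free c1 && loop_free c2
  | _ => true
  end.

Lemma wp_run c (Q : state -> Prop) s : loop_free c -> Q (run c s) -> wp c (run_time c) Q s.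
Proof.
elim: c Q s => [|x e|a e1 e2|c1 IH1 c2 IH2|e c1 IH1 c2 IH2|//] Q s /=.
- by move=> _; exact: wp_skip.
- by move=> _; exact: wp_assign.
- by move=> _ q; eexists _, _; split; [exact: ExecWrite| |].
- by move=> /andP[lf1 lf2] q; apply/wp_seq/IH1 => //; exact: IH2.
- move=> /andP[lf1 lf2] q; apply: wp_if => [pos|neg].
    by apply: IH1 => //; rewrite pos in q.
  by apply: IH2 => //; rewrite ltNge neg in q.
Qed.

Definition For (x : nat) (e : expr) (c : cmd) : cmd :=
  Seq (Assign x (Const 0))
      (While (Op Sub e (Var x)) (Seq c (Assign x (Op Add (Var x) (Const 1))))).

(** A round pays [cost e + 3] for the test, [T] for the body and 4 for the increment. Outside the
    rounds there are 2 for the initialization and [cost e + 3] for the failing test. *)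
Definition for_time (e : expr) (n T : nat) : nat :=
  (n * (T + cost e + 7) + cost e + 5)%N.

(** [I k] describes the state after [k] rounds with the counter already incremented. The bound [e]
    is evaluated again at each test, hence the demand that it equal [n] in every invariant state. *)
Lemma wp_for x e c (n T : nat) (I : nat -> state -> Prop) (Q : state -> Prop) s :
  (forall k s, I k s -> eval s e = n) ->
  (forall k s, (k < n)%N -> I k s -> vars s x = k ->
     wp c T (fun s' => vars s' x = k /\ I k.+1 (set_var s' x k.+1)) s) ->
  I 0%N (set_var s x 0) -> (forall s, I n s -> Q s) ->
  wp (For x e c) (for_time e n T) Q s.
Proof.
move=> bound body I0 IQ.
have -> : for_time e n T = (2 + (n * (T + cost e + 7) + cost e + 3))%N.
  by rewrite /for_time; lia.
apply/wp_seq/wp_assign => /=.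
have x0 : vars (set_var s x 0) x = 0%N by rewrite /= eqxx.
(* Induction on the number [d] of remaining rounds. *)
suff loop d k s0 : (k + d = n)%N -> I k s0 -> vars s0 x = k ->
    wp (While (Op Sub e (Var x)) (Seq c (Assign x (Op Add (Var x) (Const 1)))))
       (d * (T + cost e + 7) + cost e + 3) Q s0 by exact: (loop n 0%N).
clear s I0 x0; elim: d k s0 => [|d IHd] k s dE Ik xk.
  have k_eq : k = n by lia.
  exists (cost (Op Sub e (Var x))).+1, s; split; [|rewrite /=; lia|by apply: IQ; rewrite -k_eq].
  by apply: ExecWhileFalse; rewrite /= (bound _ _ Ik) xk k_eq subrr.
have lt_kn : (k < n)%N by lia.
have [t1 [s1 [ex1 le1 [x1 I1]]]] := body k s lt_kn Ik xk.
have x1' : vars (set_var s1 x k.+1) x = k.+1 by rewrite /= eqxx.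
have [|t2 [s2 [ex2 le2 q]]] := IHd k.+1 _ _ I1 x1'; first lia.
exists (cost (Op Sub e (Var x)) + (t1 + 4) + t2).+1, s2; split=> //.
  apply: ExecWhileTrue ex2; first by rewrite /= (bound _ _ Ik) xk; lia.
  apply: ExecSeq ex1 _.
  have -> : Posz k.+1 = eval s1 (Op Add (Var x) (Const 1)) by rewrite /= x1; lia.
  exact: ExecAssign.
by rewrite /=; lia.
Qed.

(** * Push-relabel as a program: pushes *)

(* Variable 2 holds the number [N] of nodes; the arrays 3, 4 and 5 hold the
   excesses, the labels and the residual capacities (of [(u, v)] in cell
   [u * N + v]); the variables 8 and 9 are the current arc. *)
Definition vN := Var 2.
Definition vu := Var 8.
Definition vv := Var 9.
Definition vd := Var 10.
Definition cell u v := Op Add (Op Mul u vN) v.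

Definition holds (N : nat) (g : preflow) (s : state) : Prop :=
  [/\ vars s 2 = N,
      forall u, (u < N)%N -> arrs s 3 u = ex g u,
      forall u, (u < N)%N -> arrs s 4 u = lab g u
    & forall u v, (u < N)%N -> (v < N)%N -> arrs s 5 (u * N + v)%N = res g u v].

Definition move_cmd : cmd :=
  Seq (Write 3 vu (Op Sub (Read 3 vu) vd))
  (Seq (Write 3 vv (Op Add (Read 3 vv) vd))
  (Seq (Write 5 (cell vu vv) (Op Sub (Read 5 (cell vu vv)) vd))
       (Write 5 (cell vv vu) (Op Add (Read 5 (cell vv vu)) vd)))).

Definition amount_cmd : cmd :=
  Seq (Assign 10 (Read 3 vu))
      (If (Op Sub vd (Read 5 (cell vu vv)))
        (Assign 10 (Read 5 (cell vu vv))) Skip).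

Definition push_cmd : cmd :=
  If (Read 5 (cell vu vv))
    (If (Op Sub (Read 4 vu) (Read 4 vv))
      (If (Read 3 vu) (Seq amount_cmd move_cmd) Skip) Skip) Skip.

Lemma cell_inj (N u v u' v' : nat) : (v < N)%N -> (v' < N)%N ->
  (u * N + v == u' * N + v')%N = (u == u') && (v == v').
Proof.
move=> vN v'N; apply/eqP/andP => [E|[/eqP-> /eqP->]] //.
have := congr1 (edivn^~ N) E; rewrite !edivn_eq // => -[-> ->].
by rewrite !eqxx.
Qed.

Lemma eq_intE (i j : nat) : (Posz i == Posz j) = (i == j).
Proof. by []. Qed.

Lemma move_cmdP (N : nat) (g : preflow) (s : state) (u v : nat) (d : int) :
  holds N g s -> (u < N)%N -> (v < N)%N -> u != v ->
  vars s 8 = u -> vars s 9 = v -> vars s 10 = d ->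
  vars (run move_cmd s) = vars s /\ holds N (push g u v d) (run move_cmd s).
Proof.
move=> [sN sex slab sres] uN vN uv su sv sd; split=> //.
have cuv : u%:Z * N + v = (u * N + v)%N by lia.
have cvu : v%:Z * N + u = (v * N + u)%N by lia.
have vu : (v == u) = false by rewrite eq_sym (negbTE uv).
split=> //.
- move=> w wN /=; rewrite su sv sd !eq_intE vu.
  have [->|wu] := eqVneq w u; first by rewrite (negbTE uv) sex //=; lia.
  by have [->|wv] := eqVneq w v; rewrite sex //=; lia.
- move=> w z wN zN /=; rewrite su sv sd sN cuv cvu !eq_intE !cell_inj // vu /=.
  have [->|wu] := eqVneq w u; have [->|zv] := eqVneq z v; rewrite ?vu ?(negbTE uv) /=.
  all: try by rewrite sres //; lia.
  + by rewrite andbF sres //; lia.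
  + by have [->|wv] := eqVneq w v; have [->|zu] := eqVneq z u; rewrite /= sres //; lia.
Qed.

Lemma amount_cmdP (N : nat) (g : preflow) (s : state) (u v : nat) :
  holds N g s -> (u < N)%N -> (v < N)%N -> vars s 8 = u -> vars s 9 = v ->
  [/\ arrs (run amount_cmd s) = arrs s,
      vars (run amount_cmd s) 10 = Num.min (ex g u) (res g u v)
    & forall x, x != 10%N -> vars (run amount_cmd s) x = vars s x].
Proof.
move=> [sN sex slab sres] uN vN su sv.
have cuv : u%:Z * N + v = (u * N + v)%N by lia.
rewrite /= su sv sN cuv sres // sex // subr_gt0; case: ltP => d_cmp; split=> //=.
all: by move=> x /negbTE->.
Qed.

Lemma push_cmdP (N : nat) (g : preflow) (s : state) (u v : nat) :
  holds N g s -> (u < N)%N -> (v < N)%N -> vars s 8 = u -> vars s 9 = v ->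
  (forall x, x != 10%N -> vars (run push_cmd s) x = vars s x) /\
  holds N (if downhill g u v && (0 < ex g u)
    then push g u v (Num.min (ex g u) (res g u v)) else g) (run push_cmd s).
Proof.
move=> hold uN vN su sv; have [sN sex slab sres] := hold.
have cuv : u%:Z * N + v = (u * N + v)%N by lia.
have [arr_am d_am vars_am] := amount_cmdP hold uN vN su sv.
have -> : run push_cmd s = if (0 < res g u v) && (lab g v < lab g u)%N && (0 < ex g u)
    then run move_cmd (run amount_cmd s) else s.
  rewrite /push_cmd; move: amount_cmd move_cmd {hold arr_am d_am vars_am} => c1 c2.
  rewrite /= su sv sN cuv sres // !slab // !sex // subr_gt0 ltz_nat.
  by case: (0 < _) => //; case: (_ < _)%N => //; case: (0 < _).
rewrite -/(downhill g u v); case: ifP => // /andP[/andP[_ luv] exu].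
have ne_uv : u != v by apply/eqP => E; rewrite E ltnn in luv.
have hold' : holds N g (run amount_cmd s) by split; rewrite ?arr_am ?vars_am.
have [vE hold2] := move_cmdP hold' uN vN ne_uv (etrans (vars_am 8%N isT) su)
  (etrans (vars_am 9%N isT) sv) d_am.
by split=> // x x10; rewrite vE vars_am.
Qed.

Lemma holds_set_var N g s x v : holds N g s -> x != 2%N -> holds N g (set_var s x v).
Proof. by move=> [sN sex slab sres] x2; split=> //=; rewrite eq_sym (negbTE x2). Qed.

(** * Discharging, sweeping and the number of phases *)

Definition relabel_cmd : cmd :=
  If (Read 3 vu) (Write 4 vu (Op Add (Read 4 vu) (Const 1))) Skip.

Definition discharge_cmd : cmd :=
  If (Read 3 vu)
    (If (Op Sub vN (Read 4 vu)) (Seq (For 9 vN push_cmd) relabel_cmd) Skip)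
    Skip.

(** [W] is the net supply of a reference preflow, kept fixed so that consecutive steps chain. With
    [g' = g] it says only that [g] is valid with net supply [W]. *)
Definition progress (N : nat) (W : pred nat -> int) (g g' : preflow) : Prop :=
  [/\ valid N g', forall X, net_supply N g' X = W X
    & g' = g \/ (potential N g' < potential N g)%N].

Definition scan_time (N : nat) : nat := for_time vN N (run_time push_cmd).

(** One pass over the arcs out of [u] suffices: labels stay fixed, and a push out of [u] raises no
    residual capacity of an arc out of [u], so arcs already scanned do not become downhill again. *)
Lemma scanP (N : nat) (W : pred nat -> int) (g : preflow) (s : state) (u : nat) :
  holds N g s -> progress N W g g -> (u < N)%N -> vars s 8 = u ->
  wp (For 9 vN push_cmd) (scan_time N)
    (fun s' => [/\ vars s' 7 = vars s 7, vars s' 8 = u &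
       exists g', [/\ holds N g' s', progress N W g g', lab g' = lab g &
         0 < ex g' u -> forall v, (v < N)%N -> ~~ downhill g' u v]]) s.
Proof.
move=> hold [val0 W0 _] uN su.
pose I k s' := [/\ vars s' 7 = vars s 7, vars s' 8 = u &
       exists g', [/\ holds N g' s', progress N W g g', lab g' = lab g &
         0 < ex g' u -> forall v, (v < k)%N -> ~~ downhill g' u v]].
apply: (@wp_for _ _ _ N _ I) => //.
- by move=> k s' [_ _ [g' [[]]]].
- move=> k s1 kN [s17 s18 [g1 [hold1 [val1 W1 prog1] lab1 down1]]] s19.
  apply: wp_run => //.
  have [fr] := push_cmdP hold1 uN kN s18 s19.
  move: (run push_cmd s1) fr => s2 fr; rewrite !fr //.
  case: ifP => [/andP[dh exu]|nd] hold2; split=> //; split; rewrite /= ?fr //.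
    set d := Num.min _ _ in hold2.
    have ruk : 0 < res g1 u k by case/andP: dh.
    have luk : (lab g1 k < lab g1 u)%N by case/andP: dh.
    have [d_ex d_res] : d <= ex g1 u /\ d <= res g1 u k by rewrite /d; split; lia.
    have d_gt0 : 0 < d by rewrite /d; lia.
    exists (push g1 u k d); split=> //.
    + split; first exact: valid_push (ltW d_gt0) d_ex d_res.
        by move=> X; rewrite net_supply_push.
      right; have : (potential N (push g1 u k d) < potential N g1)%N.
        by apply: potential_push => //; rewrite /d; lia.
      by case: prog1 => [->//|lt1 lt2]; exact: ltn_trans lt2 lt1.
    + move=> ex2 v; rewrite ltnS leq_eqVlt.
      have ku : (k == u) = false by apply/eqP => E; rewrite E ltnn in luk.
      move: ex2 => /=; rewrite eqxx [u == k]eq_sym ku addr0 => ex2.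
      (* Excess remains after the push, so the minimum was the residual capacity and the arc is
         saturated. *)
      have dE : d = res g1 u k by move: ex2; rewrite /d; lia.
      move=> /orP[/eqP->|vk]; rewrite /downhill /= eqxx [u == k]eq_sym ku /=.
        by rewrite eqxx dE subrr addr0 ltxx.
      have := down1 exu v vk; rewrite /downhill /=.
      by case: (v == k); rewrite /= ?subr0 ?addr0 //; lia.
  exists g1; split=> // exu v; rewrite ltnS leq_eqVlt => /orP[/eqP->|]; last exact: down1.
  by move: nd; rewrite exu andbT => ->.
- by split=> //; exists g; split=> //; split=> //; left.
Qed.

Definition discharge_time (N : nat) : nat :=
  (cost (Read 3 vu) + ((cost (Op Sub vN (Read 4 vu))
     + (scan_time N + run_time relabel_cmd + 1)).+1 + 1)).+1%N.

Lemma dischargeP (N : nat) (W : pred nat -> int) (g : preflow) (s : state) (u : nat) :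
  holds N g s -> progress N W g g -> (u < N)%N -> vars s 8 = u ->
  wp discharge_cmd (discharge_time N)
    (fun s' => [/\ vars s' 7 = vars s 7, vars s' 8 = u &
       exists g', [/\ holds N g' s', progress N W g g' &
         if active N g u then is_true (potential N g' < potential N g)%N else g' = g]]) s.
Proof.
move=> hold prog uN su; have [sN sex slab sres] := hold.
have Es : eval s (Read 3 vu) = ex g u by rewrite /= su sex.
have El : eval s (Op Sub vN (Read 4 vu)) = N%:Z - (lab g u)%:Z by rewrite /= su sN slab.
have skip : ~~ active N g u -> wp Skip 1 (fun s' => [/\ vars s' 7 = vars s 7, vars s' 8 = u &
       exists g', [/\ holds N g' s', progress N W g g' &
         if active N g u then is_true (potential N g' < potential N g)%N else g' = g]]) s.
  by move=> /negbTE->; apply: wp_skip; split=> //; exists g.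
apply: wp_if => [|ex_le0]; last first.
  by apply: skip; rewrite /active negb_and -leNgt -Es ex_le0.
rewrite Es => exu; apply: wp_if => [|lab_ge]; last first.
  by apply: skip; rewrite /active negb_and -leqNgt; apply/orP; right; move: lab_ge; rewrite El; lia.
rewrite El => labu; have act : active N g u by rewrite /active exu; lia.
rewrite act; apply: wp_seq.
apply: wp_mono (leqnn _) _ (scanP hold prog uN su) => s1 [s17 s18 [g1 [hold1 prog1 lab1 down1]]].
apply: wp_run => //.
have [s1N s1ex s1lab s1res] := hold1; have [val1 W1 pot1] := prog1.
rewrite /= s18 s1ex // s1lab //.
case: ltP => [exu1|exu1]; last first.
  (* The excess of [u] was positive and is gone, so the scan changed the preflow and lowered the
     potential. *)
  split=> //; exists g1; split=> //; case: pot1 => // E; move: exu1; rewrite E; lia.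
split=> //; exists (relabel g1 u).
have act1 : active N g1 u by rewrite /active exu1 lab1; case/andP: act.
have pot2 : (potential N (relabel g1 u) < potential N g)%N.
  have := potential_relabel uN act1.
  by case: pot1 => [->//|lt1 lt2]; exact: ltn_trans lt2 lt1.
split=> //.
- split=> //= w wN; rewrite eq_intE; have [->|wu] := eqVneq w u; first lia.
  by rewrite s1lab // addn0.
- split=> //; last by right.
  by apply: valid_relabel => //; exact: down1.
Qed.

Definition sweep_time (N : nat) : nat := for_time vN N (discharge_time N).

Lemma sweepP (N : nat) (W : pred nat -> int) (g : preflow) (s : state) :
  holds N g s -> progress N W g g ->
  wp (For 8 vN discharge_cmd) (sweep_time N)
    (fun s' => vars s' 7 = vars s 7 /\
       exists g', [/\ holds N g' s', progress N W g g' &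
         if [exists u : 'I_N, active N g u]
         then is_true (potential N g' < potential N g)%N else g' = g]) s.
Proof.
move=> hold [val0 W0 _].
pose I k s' := vars s' 7 = vars s 7 /\
       exists g', [/\ holds N g' s', progress N W g g' &
         if [exists u : 'I_N, (u < k)%N && active N g u]
         then is_true (potential N g' < potential N g)%N else g' = g].
apply: (@wp_for _ _ _ N _ I).
- by move=> k s' [_ [g' [[]]]].
- move=> k s1 kN [s17 [g1 [hold1 [val1 W1 pot1] dec1]]] s18.
  have prog1 : progress N W g1 g1 by split=> //; left.
  apply: wp_mono (leqnn _) _ (dischargeP hold1 prog1 kN s18)
    => s2 [s27 s28 [g2 [hold2 [val2 W2 pot2] dec2]]].
  split=> //; split; first by rewrite /= s27.
  exists g2; split; first exact: holds_set_var.
    split=> //; case: pot1 pot2 => [->|lt1] [->|lt2]; [by left|by right|by right|].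
    by right; exact: ltn_trans lt2 lt1.
  have -> : [exists u : 'I_N, (u < k.+1)%N && active N g u] =
     [exists u : 'I_N, (u < k)%N && active N g u] || active N g k.
    apply/existsP/orP => [[w /andP[]]|[/existsP[w /andP[wk aw]]|ak]].
    - rewrite ltnS leq_eqVlt => /orP[/eqP->|wk] aw; first by right.
      by left; apply/existsP; exists w; rewrite wk.
    - by exists w; rewrite ltnW.
    - by exists (Ordinal kN); rewrite /= ltnSn.
  (* Until an active node is met the preflow is still [g], so activity of [k] in [g] and in the
     current preflow coincide. *)
  move: dec1; case: [exists _, _] => /= [lt1|E1].
    by case: pot2 => [->//|lt2]; exact: ltn_trans lt2 lt1.
  by rewrite -E1.
- split=> //; exists g; split; [exact: holds_set_var|by split; [..|left]|].
  by case: existsP => // -[w].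
- move=> s' [s'7 [g' [hold' prog' dec']]]; split=> //; exists g'; split=> //.
  by move: dec'; under eq_existsb do rewrite ltn_ord.
Qed.

(** One more than a bound on the potential at zero labels, where an arc counts for at most
    [2 * N + 1] and a node for at most [2 * N]. Hence not all of these sweeps can lower the
    potential. *)
Definition phases (N : nat) : nat := (N.+1 * (N * (N * (2 * N + 1))) + 2 * N * N + 1)%N.
Definition phases_expr : expr :=
  Op Add (Op Add
    (Op Mul (Op Add vN (Const 1))
       (Op Mul vN (Op Mul vN (Op Add (Op Mul (Const 2) vN) (Const 1)))))
    (Op Mul (Op Mul (Const 2) vN) vN)) (Const 1).

Lemma potential_lt_phases (N : nat) (g : preflow) :
  (forall u, lab g u = 0%N) -> (potential N g < phases N)%N.
Proof.
move=> lab0; rewrite /phases addn1 ltnS leq_add // ?leq_mul2l /=.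
  apply: (@leq_trans (\sum_(u < N) (N * (2 * N + 1)))).
    apply: leq_sum => u _; apply: (@leq_trans (\sum_(v < N) (2 * N + 1))).
      by apply: leq_sum => v _; rewrite /arc_potential; case: downhill; lia.
    by rewrite sum_nat_const card_ord.
  by rewrite sum_nat_const card_ord.
apply: (@leq_trans (\sum_(u < N) (2 * N))).
  by apply: leq_sum => u _; rewrite /node_potential lab0; lia.
by rewrite sum_nat_const card_ord mulnC.
Qed.

Definition flow_time (N : nat) : nat := for_time phases_expr (phases N) (sweep_time N).

Lemma flowP (N : nat) (g : preflow) (s : state) :
  holds N g s -> valid N g -> (forall u, lab g u = 0%N) ->
  wp (For 7 phases_expr (For 8 vN discharge_cmd)) (flow_time N)
    (fun s' => exists g', [/\ holds N g' s', valid N g',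
       forall X, net_supply N g' X = net_supply N g X
     & forall u, (u < N)%N -> ~~ active N g' u]) s.
Proof.
move=> hold val0 lab0.
pose I k s' := exists g', [/\ holds N g' s', valid N g',
       forall X, net_supply N g' X = net_supply N g X
     & ~~ [exists u : 'I_N, active N g' u] \/ (potential N g' + k <= potential N g)%N].
apply: (@wp_for _ _ _ (phases N) _ I).
- by move=> k s' [g' [[sN]]] *; rewrite /= sN /phases; lia.
- move=> k s1 _ [g1 [hold1 val1 W1 dec1]] s17.
  have prog1 : progress N (net_supply N g) g1 g1 by split=> //; left.
  apply: wp_mono (leqnn _) _ (sweepP hold1 prog1) => s2 [s27 [g2 [hold2 [val2 W2 _] dec2]]].
  split; first by rewrite s27.
  (* A sweep without active nodes changes nothing, so the surplus sweeps are harmless; any other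
     sweep lowers the potential. *)
  exists g2; split=> //; move: dec2 dec1; case: ifP => [_|na ->]; last by left; rewrite na.
  by move=> lt [//|le]; right; lia.
- by exists g; split=> //; right; rewrite addn0.
- move=> s' [g' [hold' val' W' dec']]; exists g'; split=> // u uN.
  case: dec' => [|le]; last by have := potential_lt_phases N lab0; lia.
  by rewrite negb_exists => /forallP/(_ (Ordinal uN)).
Qed.

Definition verdict_cmd : cmd := If (Read 3 vu) (Assign 0 (Const 0)) Skip.
Definition verdict_time (N : nat) : nat := for_time vN N (run_time verdict_cmd).

Lemma verdictP (N : nat) (g : preflow) (s : state) :
  holds N g s -> vars s 0 = 1 ->
  wp (For 8 vN verdict_cmd) (verdict_time N)
    (fun s' => vars s' 0 = (nat_of_bool [forall u : 'I_N, ex g u <= 0])%:Z) s.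
Proof.
move=> hold s0.
pose I k s' := holds N g s' /\
  vars s' 0 = (nat_of_bool [forall u : 'I_N, (u < k)%N ==> (ex g u <= 0)])%:Z.
apply: (@wp_for _ _ _ N _ I).
- by move=> k s' [[]].
- move=> k s1 kN [hold1 s10] s18; apply: wp_run => //.
  have -> : run verdict_cmd s1 = if 0 < ex g k then set_var s1 0 0 else s1.
    by case: hold1 => _ s1ex _ _; rewrite /= s18 s1ex.
  split; first by case: ifP.
  split; first by case: ifP => _; rewrite ?holds_set_var //; apply: holds_set_var.
  have -> : [forall u : 'I_N, (u < k.+1)%N ==> (ex g u <= 0)] =
     [forall u : 'I_N, (u < k)%N ==> (ex g u <= 0)] && (ex g k <= 0).
    apply/forallP/andP => [H|[/forallP H exk] w].
      split; last by have := H (Ordinal kN); rewrite /= ltnSn.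
      by apply/forallP => w; apply/implyP => wk; have := H w; rewrite ltnW.
    apply/implyP; rewrite ltnS leq_eqVlt => /orP[/eqP->//|wk].
    by have := H w; rewrite wk.
  by case: ltP => exk; rewrite /= ?andbT ?andbF.
- split; first exact: holds_set_var.
  by rewrite /= s0; case: forallP => // -[].
- by move=> s' [_ ->]; congr (Posz (nat_of_bool _)); apply: eq_forallb => u; rewrite ltn_ord.
Qed.

(** * The network of a compression *)

(* Node [s < m] is row [s], with supply [a s]; node [k.+1 * m + s] stands for
   row [s] of block [k], with a demand of [lam k] if [s] is in [R_k].  The
   [lam k] columns of the block can receive at most [lam k] copies of a row,
   and unused copies are passed down the block. *)
Definition network (m : nat) (a lam mem : nat -> nat) (big : nat) : preflow :=
  Preflow
    (fun w => if (w < m)%N then (a w)%:Z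
              else - (lam (w %/ m).-1 * mem (w - m))%N%:Z)
    (fun=> 0%N)
    (fun u v => if (v < m)%N then 0
       else (lam (v %/ m).-1)%:Z *+ (u == v %% m)%N
            + big%:Z *+ ((0 < v %% m)%N && (u == v.-1))).

Lemma valid_network N m a lam mem big : valid N (network m a lam mem big).
Proof.
split=> //= u v _ _; case: ifP => // _.
by apply: addr_ge0; apply: mulrn_wge0.
Qed.

Lemma divn_node m k s : (s < m)%N -> ((k * m + s) %/ m = k)%N.
Proof. by move=> sm; rewrite divnMDl ?divn_small ?addn0 //; lia. Qed.

Lemma modn_node m k s : (s < m)%N -> ((k * m + s) %% m = s)%N.
Proof. by move=> sm; rewrite modnMDl modn_small. Qed.

Lemma node_lt m l k s : (s < m)%N -> (k < l)%N -> (k.+1 * m + s < l.+1 * m)%N.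
Proof.
move=> sm kl; have : (k.+2 * m <= l.+1 * m)%N by rewrite leq_mul2r ltnS kl orbT.
by lia.
Qed.

Lemma sum_nodes (l m : nat) (F : nat -> int) :
  \sum_(w < l.+1 * m) F w =
    \sum_(i < m) F i + \sum_(k < l) \sum_(s < m) F (k.+1 * m + s)%N.
Proof.
elim: l => [|l IHl]; first by rewrite mul1n big_ord0 addr0.
rewrite big_ord_recr /= addrA -IHl mulSn addnC big_split_ord /=.
by congr (_ + _); apply: eq_bigr => s _; rewrite mulSn addnC.
Qed.

(** The capacity that block [k] opposes to the cut [X]: arcs from rows of [X] to nodes outside,
    demands met inside [X], and unbounded arcs leaving [X] down the block. *)
Definition block_cut m (lam mem : nat -> nat) (big : nat) (X : pred nat) (k : nat) : nat :=
  (\sum_(s < m | X s && ~~ X (k.+1 * m + s)) lam k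
   + \sum_(s < m | X (k.+1 * m + s)) lam k * mem (k * m + s)
   + \sum_(s < m | [&& 0 < s, X (k.+1 * m + s).-1 & ~~ X (k.+1 * m + s)]) big)%N.

Lemma net_supply_network m l a lam mem big (X : pred nat) :
  net_supply (l.+1 * m) (network m a lam mem big) X =
  (\sum_(i < m | X i) a i)%N%:Z - (\sum_(k < l) block_cut m lam mem big X k)%N%:Z.
Proof.
have PoszS I (r : seq I) (P : pred I) (F : I -> nat) :
  (\sum_(i <- r | P i) F i)%N%:Z = \sum_(i <- r | P i) (F i)%:Z.
  exact: (big_morph Posz PoszD (erefl _)).
rewrite /net_supply sumrB.
have -> : \sum_(u < l.+1 * m | X u) ex (network m a lam mem big) u =
  (\sum_(i < m | X i) a i)%N%:Z -
   (\sum_(k < l) \sum_(s < m | X (k.+1 * m + s)) lam k * mem (k * m + s))%N%:Z.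
  rewrite big_mkcond (sum_nodes l m (fun u =>
    if X u then ex (network m a lam mem big) u else 0)) /=.
  congr (_ + _).
    by rewrite PoszS [RHS]big_mkcond; apply: eq_bigr => i _; rewrite ltn_ord.
  rewrite PoszS -sumrN; apply: eq_bigr => k _; rewrite PoszS -sumrN [RHS]big_mkcond.
  apply: eq_bigr => s _; rewrite divn_node // ltnNge mulSn -addnA leq_addr /=.
  by rewrite addKn.
(* The arcs are grouped by their heads; no arc enters a row. *)
rewrite exchange_big [X in _ - X = _]big_mkcond (sum_nodes l m (fun v => if ~~ X v then
  \sum_(u < l.+1 * m | X u) res (network m a lam mem big) u v else 0)) /=.
rewrite [X in _ - (X + _)]big1 ?add0r; last first.
  by move=> i _; rewrite ltn_ord big1 // if_same.
rewrite -addrA -opprD; congr (_ - _); rewrite [in RHS]PoszS [in LHS]PoszS -big_split /=.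
apply: eq_bigr => k _; rewrite /block_cut 2!PoszD !PoszS.
rewrite [RHS]addrAC [LHS]addrC; congr (_ + _).
rewrite [X in _ = X + _]big_mkcond [X in _ = _ + X]big_mkcond -big_split /=.
apply: eq_bigr => s _; have lt_s := ltn_ord s.
have nlt : (k.+1 * m + s < m)%N = false by rewrite mulSn; lia.
rewrite nlt divn_node // modn_node // big_split /= sum_indic; last first.
  by have := node_lt lt_s (ltn_ord k); rewrite mulSn; lia.
have -> : \sum_(u < l.+1 * m | X u)
   big%:Z *+ ((0 < val s)%N && (val u == (k.+1 * m + s).-1)) =
   big%:Z *+ ((0 < val s)%N && X (k.+1 * m + s).-1).
  case: (0 < val s)%N; last by rewrite big1.
  rewrite /= sum_indic //.
  by have := node_lt lt_s (ltn_ord k); lia.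
case: (X (k.+1 * m + s)); rewrite ?andbF //= !andbT.
by case: (X s); case: (_ && _).
Qed.

(** * Theta of a compressed diagram as a minimum cut *)

Lemma theta_col_column n (D : {set 'I_n * 'I_n}) (S : {set 'I_n}) (c c' : 'I_n) :
  column D c = column D c' -> theta_col D S c = theta_col D S c'.
Proof.
move=> E; rewrite /theta_col; suff -> : word D S c = word D S c' by [].
apply: eq_pmap => r; rewrite /letter; move/setP/(_ r): E; rewrite !inE => ->.
by [].
Qed.

Lemma theta_col0 n (D : {set 'I_n * 'I_n}) (S : {set 'I_n}) (c : 'I_n) :
  column D c = finset.set0 -> theta_col D S c = 0%N.
Proof.
move=> E; apply/eqP; rewrite -leqn0; apply: leq_trans (theta_col_le_cut D S c 0) _.
rewrite big1 ?add0n // big1 // => r _; move/setP/(_ r): E; rewrite !inE => ->.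
by [].
Qed.

(** A nonempty column lies in exactly one block and agrees there with the representative; empty
    columns contribute zero, in a block or not. *)
Lemma theta_blocks n (D : {set 'I_n * 'I_n}) (C : compression D) (S : {set 'I_n}) :
  theta D S = (\sum_(k < cl C) cmult C k * theta_col D S (crep C k))%N.
Proof.
transitivity (\sum_(c < n) \sum_(k < cl C | c \in cblock C k) theta_col D S c)%N.
  apply: eq_bigr => c _; have [c0|c0] := eqVneq (column D c) finset.set0.
    by rewrite theta_col0 // big1.
  have [k ck] := cblock_cover C c0; rewrite (bigD1 k) //= big1 ?addn0 // => k' /andP[ck' kk'].
  have := cblock_disjoint kk'; rewrite disjoint_subset => /fintype.subsetP/(_ c ck').
  by rewrite inE ck.
rewrite (exchange_big_dep predT) //=; apply: eq_bigr => k _.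
rewrite cmultE -sum_nat_const; apply: eq_bigr => c ck.
exact: theta_col_column (cblock_column ck (crep_in k)).
Qed.

Lemma sum_widen m n (le_mn : (m <= n)%N) (P : pred 'I_n) (F : 'I_n -> nat) :
  (\sum_(i < m | P (widen_ord le_mn i)) F (widen_ord le_mn i) <= \sum_(i < n | P i) F i)%N.
Proof.
rewrite -(big_ord_narrow_cond le_mn) big_mkcondr /=.
by apply: leq_sum => i _; case: ifP.
Qed.

Lemma sum_widen_eq m n (le_mn : (m <= n)%N) (P : pred 'I_n) (F : 'I_n -> nat) :
  (forall i : 'I_n, (m <= i)%N -> P i -> F i = 0%N) ->
  (\sum_(i < n | P i) F i = \sum_(i < m | P (widen_ord le_mn i)) F (widen_ord le_mn i))%N.
Proof.
move=> F0; rewrite -(big_ord_narrow_cond le_mn) [RHS]big_mkcondr /=.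
by apply: eq_bigr => i Pi; case: ltnP => // /F0->.
Qed.

Lemma sum_if_mul (I : finType) (P : pred I) (x : nat) (b : I -> bool) :
  (\sum_(i | P i && b i) x = x * \sum_(i | P i) b i)%N.
Proof.
rewrite big_distrr big_mkcondr /=; apply: eq_bigr => i _.
by case: (b i); rewrite ?muln1 ?muln0.
Qed.

(** Turns a cut that crosses no unbounded arc of a block into a cut position of its column. *)
Lemma threshold m (P : pred nat) :
  (forall s, (s < m)%N -> (0 < s)%N -> P s.-1 -> P s) ->
  exists t, forall s, (s < m)%N -> P s = (t <= s)%N.
Proof.
move=> up; elim: m up => [|m IHm] up; first by exists 0%N.
have [t tP] := IHm (fun s sm => up s (ltnW sm)).
have [Pm|nPm] := boolP (P m); last first.
  (* If [P] fails at the last place it fails everywhere, so the threshold lies past the end. *)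
  exists m.+1 => s; rewrite ltnS leq_eqVlt => /orP[/eqP->|sm].
    by rewrite ltnn (negbTE nPm).
  rewrite ltnNge ltnW //=; apply/negbTE/negP => Ps.
  have Pall j : (s + j <= m)%N -> P (s + j)%N.
    elim: j => [|j IHj] le; first by rewrite addn0.
    by apply: up; [lia|lia|rewrite addnS; apply: IHj; lia].
  by have := Pall (m - s)%N; rewrite (subnKC (ltnW sm)) leqnn (negbTE nPm) => /(_ isT).
exists (minn t m) => s; rewrite ltnS leq_eqVlt => /orP[/eqP->|sm].
  by rewrite Pm geq_minr.
by rewrite tP // geq_min [(m <= s)%N]leqNgt sm orbF.
Qed.

Lemma theta_le_cuts n (D : {set 'I_n * 'I_n}) (C : compression D)
  (a : nat -> nat) (lam mem : nat -> nat) :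
  (forall k : 'I_(cl C), lam k = cmult C k) ->
  (forall (k : 'I_(cl C)) (s : 'I_(cm C)),
     mem (k * cm C + s)%N = ((widen_ord (cm_le C) s, crep C k) \in D)) ->
  (forall X, net_supply ((cl C).+1 * cm C)
     (network (cm C) a lam mem (\sum_(i < cm C) a i)) X <= 0) <->
  (forall S : {set 'I_n},
     \sum_(i < cm C | widen_ord (cm_le C) i \in S) a i <= theta D S)%N.
Proof.
move=> lamE memE; set m := cm C; set big := (\sum_(i < m) a i)%N.
set w : 'I_m -> 'I_n := widen_ord (cm_le C).
have supply_le0 X : (net_supply ((cl C).+1 * m) (network m a lam mem big) X <= 0) =
   (\sum_(i < m | X i) a i <= \sum_(k < cl C) block_cut m lam mem big X k)%N.
  by rewrite net_supply_network subr_le0 lez_nat.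
split=> [cuts S|memb X]; last first.
  rewrite supply_le0.
  (* A crossed unbounded arc has as capacity the total supply, so such a cut is never violated. *)
  have [/existsP[k /existsP[s cut]]|closed] := boolP [exists k : 'I_(cl C), [exists s : 'I_m,
     [&& (0 < s)%N, X (k.+1 * m + s).-1 & ~~ X (k.+1 * m + s)%N]]].
    apply: (@leq_trans big).
      by rewrite /big [X in (_ <= X)%N](bigID (fun i : 'I_m => X i)) leq_addr.
    rewrite (bigD1 k) //= /block_cut [X in (_ + X + _)%N](bigD1 s) //=.
    by lia.
  pose S := [set i : 'I_n | (i < m)%N && X i].
  have := memb S; under eq_bigl do rewrite inE /= ltn_ord /=.
  move=> /leq_trans; apply; rewrite (theta_blocks C).
  apply: leq_sum => k _.
  have [|t tP] := @threshold m (fun s => X (k.+1 * m + s)%N).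
    move=> s sm s_gt0 Xs; apply: contraNT closed => nXs.
    apply/existsP; exists k; apply/existsP; exists (Ordinal sm) => /=.
    by rewrite s_gt0 nXs -subn1 -addnBA // subn1 Xs.
  (* Block [k] of the cut corresponds to position [t], and weak duality bounds theta by the value
     there. *)
  have := theta_col_le_cut D S (crep C k) t.
  rewrite (sum_widen_eq (cm_le C)); last by move=> i mi _; rewrite inE ltnNge mi.
  rewrite (sum_widen_eq (cm_le C)); last by move=> i mi _; rewrite (negbTE (cm_rows _ mi)).
  move=> le; apply: (leq_trans (leq_mul (leqnn (cmult C k)) le)).
  rewrite mulnDr /block_cut; apply: leq_trans (leq_addr _ _); apply: leq_add.
    rewrite -sum_if_mul lamE; apply: eq_leq; apply: eq_bigl => i.
    by rewrite inE /= ltn_ord tP // -ltnNge andbC.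
  rewrite big_distrr /=; apply: eq_leq; apply: eq_big => [i|i _]; first by rewrite tP.
  by rewrite lamE memE.
rewrite (theta_blocks C).
(* Conversely, each block is cut at an optimal position: [X] consists of the rows of [S] and of the
   nodes of block [k] from row [t k] on. The default 0 in [t'] only extends [t] to all naturals. *)
pose t (k : 'I_(cl C)) := xchoose (theta_col_ge_cut D S (crep C k)).
pose t' k := oapp t 0%N (insub k).
pose X v := if (v < m)%N then [exists j : 'I_n, (val j == v) && (j \in S)]
            else (t' (v %/ m).-1 <= v %% m)%N.
have Xrow (i : 'I_m) : X i = (w i \in S).
  rewrite /X ltn_ord; apply/existsP/idP => [[j /andP[/eqP ji jS]]|iS].
    by have <- : j = w i by apply: val_inj.
  by exists (w i); rewrite /= eqxx.
have Xnode (k : 'I_(cl C)) s : (s < m)%N -> X (k.+1 * m + s)%N = (t k <= s)%N.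
  move=> sm; have -> : X (k.+1 * m + s)%N = (t' k <= s)%N.
    rewrite /X divn_node // modn_node // ifF //; by rewrite mulSn; lia.
  by rewrite /t' valK.
have := cuts X; rewrite supply_le0.
under eq_bigl do rewrite Xrow.
move=> /leq_trans; apply; apply: leq_sum => k _.
rewrite -lamE.
apply: leq_trans (leq_mul (leqnn (lam k)) (xchooseP (theta_col_ge_cut D S (crep C k)))).
(* A final segment of a block is not left by an arc to the next row, so no unbounded arc is
   crossed. *)
rewrite -/(t k) /block_cut [X in (_ + X <= _)%N]big1 ?addn0; last first.
  move=> s /and3P[s_gt0]; rewrite -subn1 -addnBA // subn1 Xnode; last by have := ltn_ord s; lia.
  by rewrite Xnode // => /leq_trans->//; exact: leq_pred.
rewrite mulnDr; apply: leq_add.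
  rewrite -sum_if_mul.
  rewrite (eq_bigl (fun i : 'I_m => (i < t k)%N && (w i \in S))); last first.
    by move=> i; rewrite Xrow Xnode // -ltnNge andbC.
  exact: (sum_widen (cm_le C) (fun i => (i < t k)%N && (i \in S)) (fun=> lam k)).
rewrite big_distrr /= (eq_bigl (fun i : 'I_m => (t k <= i)%N)); last first.
  by move=> i; rewrite Xnode.
rewrite (eq_bigr (fun i => (lam k * ((w i, crep C k) \in D))%N)); last first.
  by move=> i _; rewrite memE.
exact: (sum_widen (cm_le C) (fun i => (t k <= i)%N) (fun i => (lam k * ((i, crep C k) \in D))%N)).
Qed.

(** The padded vector is nonnegative with the right total, and its zeros contribute to no sum, so
    only the inequalities for sets of rows remain. *)
Lemma schubitopeP (R : realType) n (D : {set 'I_n * 'I_n}) m (a : m.-tuple nat)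
    (le_mn : (m <= n)%N) :
  (\sum_(i < m) tnth a i)%N = #|D| ->
  schubitope R D (pad_zeros R n a) <->
  (forall S : {set 'I_n},
     \sum_(i < m | widen_ord le_mn i \in S) nth 0 a i <= theta D S)%N.
Proof.
move=> sumD.
have sumE (P : pred 'I_n) : \sum_(i < n | P i) pad_zeros R n a 0 i =
    (\sum_(i < m | P (widen_ord le_mn i)) nth 0%N a i)%N%:R.
  under eq_bigr do rewrite mxE.
  rewrite -natr_sum; congr _%:R.
  rewrite (sum_widen_eq le_mn) // => i mi _.
  by rewrite nth_default // size_tuple.
split=> [[_ _ le] S|le].
  by have := le S; rewrite sumE ler_nat.
split=> [i||S]; first by rewrite mxE.
- rewrite sumE -sumD; congr _%:R; apply: eq_bigr => i _.
  by rewrite (tnth_nth 0%N).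
- by rewrite sumE ler_nat.
Qed.

(** * Building the network and running the flow *)

(* Variable 3 accumulates the total supply, which serves as infinite capacity;
   the variables 4, 5 and 6 hold a block [k], a row [r] and the node
   [k.+1 * m + r]. *)
Definition row_cmd : cmd :=
  Seq (Write 3 (Var 4) (Read 0 (Var 4)))
      (Assign 3 (Op Add (Var 3) (Read 0 (Var 4)))).

(** Writes the demand of one node and the capacities of the arcs into it. Subtracting [m] from the
    node number gives its cell in the membership matrix; in row 0 there is no arc from above. *)
Definition node_cmd : cmd :=
  Seq (Write 3 (Var 6)
        (Op Sub (Const 0) (Op Mul (Read 1 (Var 4)) (Read 2 (Op Sub (Var 6) (Var 0))))))
  (Seq (Write 5 (cell (Var 5) (Var 6)) (Read 1 (Var 4)))
  (Seq (If (Var 5) (Write 5 (cell (Op Sub (Var 6) (Const 1)) (Var 6)) (Var 3)) Skip)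
       (Assign 6 (Op Add (Var 6) (Const 1))))).

Definition build_cmd : cmd :=
  Seq (Assign 2 (Op Mul (Op Add (Var 1) (Const 1)) (Var 0)))
  (Seq (For 4 (Var 0) row_cmd)
  (Seq (Assign 6 (Var 0)) (For 4 (Var 1) (For 5 (Var 0) node_cmd)))).

Definition input (m l : nat) (a lam mem : nat -> nat) (s : state) : Prop :=
  [/\ vars s 0 = m, vars s 1 = l,
      forall i : nat, arrs s 0 i = a i,
      forall k : nat, arrs s 1 k = lam k
    & forall j : nat, arrs s 2 j = mem j].

(** The nodes below [b] have their excess and incoming arcs in place; the capacities of all arcs
    with a later head are still zero. *)
Definition built (m l : nat) (a lam mem : nat -> nat) (b : nat) (s : state) : Prop :=
  let g := network m a lam mem (\sum_(i < m) a i) in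
  let N := (l.+1 * m)%N in
  [/\ input m l a lam mem s, vars s 2 = N & vars s 3 = (\sum_(i < m) a i)%N] /\
  [/\ forall u : nat, (u < b)%N -> arrs s 3 u = ex g u,
      forall u : nat, arrs s 4 u = 0
    & forall u v, (u < N)%N -> (v < N)%N ->
        arrs s 5 (u * N + v)%N = if (v < b)%N then res g u v else 0].

Definition rows_time (m : nat) : nat := for_time (Var 0) m (run_time row_cmd).

Lemma rowsP m l a lam mem s :
  input m l a lam mem s -> vars s 2 = (l.+1 * m)%N -> vars s 3 = 0 ->
  (forall b, (2 < b)%N -> arrs s b = fun=> 0) ->
  wp (For 4 (Var 0) row_cmd) (rows_time m) (built m l a lam mem m) s.
Proof.
move=> inp sN s3 arr0.
pose I k s' := [/\ input m l a lam mem s', vars s' 2 = (l.+1 * m)%N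
    & vars s' 3 = (\sum_(i < k) a i)%N] /\
  [/\ forall u : nat, (u < k)%N -> arrs s' 3 u = a u,
   arrs s' 4 = fun=> 0 & arrs s' 5 = fun=> 0].
apply: (@wp_for _ _ _ m _ I).
- by move=> k s' [[[]]].
- move=> k s1 km [[inp1 s1N s13] [s1row s14 s15]] s1k; apply: wp_run => //.
  have [_ _ a1 _ _] := inp1.
  split=> //; split; split=> //=.
  + by rewrite s13 s1k a1 big_ord_recr.
  + move=> u; rewrite ltnS leq_eqVlt s1k eq_intE => /orP[/eqP->|uk].
      by rewrite eqxx a1.
    by rewrite ifF ?s1row //; apply/eqP => E; rewrite E ltnn in uk.
- split; split=> //=; [by rewrite big_ord0|exact: arr0|exact: arr0].
- move=> s' [[inp' s'N s'3] [s'row s'4 s'5]]; split=> //; split=> //=.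
  + by move=> u um; rewrite um s'row.
  + by move=> u; rewrite s'4.
  + by move=> u v _ _; rewrite s'5; case: ltnP.
Qed.

Lemma node_cmdP m l a lam mem k r s :
  (k < l)%N -> (r < m)%N -> built m l a lam mem (k.+1 * m + r) s ->
  vars s 4 = k -> vars s 5 = r -> vars s 6 = (k.+1 * m + r)%N ->
  [/\ built m l a lam mem (k.+1 * m + r).+1 (run node_cmd s),
      vars (run node_cmd s) 4 = k, vars (run node_cmd s) 5 = r
    & vars (run node_cmd s) 6 = (k.+1 * m + r).+1].
Proof.
move=> kl rm [[inp sN s3] [sex slab sres]] sk sr sw.
set w := (k.+1 * m + r)%N in sex sres sw *.
set g := network _ _ _ _ _ in sex sres *.
set N := (l.+1 * m)%N in sN sres *.
have [sm sl sa slam smem] := inp.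
have wN : (w < N)%N by exact: node_lt.
have mw : (m <= w)%N by rewrite /w mulSn; lia.
have rN : (r < N)%N by lia.
have wm : (w %/ m).-1 = k by rewrite /w divn_node.
have wr : (w %% m = r)%N by rewrite /w modn_node.
have srest : [/\ vars (run node_cmd s) 4 = k, vars (run node_cmd s) 5 = r,
   vars (run node_cmd s) 6 = w.+1, vars (run node_cmd s) 2 = N
   & vars (run node_cmd s) 3 = vars s 3].
  by rewrite /=; case: (0 < _); rewrite /= sw; split=> //; lia.
have ex3 (u : nat) : arrs (run node_cmd s) 3 u = if u == w then ex g w else arrs s 3 u.
  have -> : arrs (run node_cmd s) 3 u =
     if Posz u == vars s 6 then 0 - arrs s 1 (vars s 4) * arrs s 2 (vars s 6 - vars s 0)
     else arrs s 3 u.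
    by rewrite /=; case: (0 < _).
  rewrite sw sk sm eq_intE slam; case: eqP => // _.
  have -> : w%:Z - m%:Z = (w - m)%N by lia.
  by rewrite smem /= ltnNge mw /= wm; lia.
have lab4 : arrs (run node_cmd s) 4 = arrs s 4 by rewrite /=; case: (0 < _).
have res5 u v : (u < N)%N -> (v < N)%N -> arrs (run node_cmd s) 5 (u * N + v)%N =
    if v == w then res g u w else arrs s 5 (u * N + v)%N.
  move=> uN vN; rewrite /= sr sw sN s3 sk slam.
  have -> : r%:Z * N%:Z + w%:Z = (r * N + w)%N by lia.
  rewrite ltnNge mw /= wm wr ltz_nat.
  case: (posnP r) => [r0|r_gt0] /=.
    rewrite eq_intE cell_inj // mulr0n addr0.
    have [->|vw] := eqVneq v w; rewrite ?andbF // andbT.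
    by case: eqP => // _; rewrite sres // ltnn.
  have -> : (w%:Z - 1) * N%:Z + w%:Z = (w.-1 * N + w)%N by nia.
  rewrite !eq_intE !cell_inj //.
  have [->|vw] := eqVneq v w; rewrite ?andbF // !andbT.
  have [->|uw] := eqVneq u w.-1.
    (* Row [r] and the preceding node are distinct tails: they could agree only for [m = 1], which
       excludes [r > 0]. So neither write overwrites the other. *)
    have -> : (w.-1 == r) = false by apply/eqP => E; move: mw; rewrite /w mulSn in E *; lia.
    by rewrite mulr0n mulr1n add0r.
  by rewrite addr0; case: eqP => // _; rewrite sres // ltnn.
have [s'4 s'5 s'6 s'N s'3] := srest.
split=> //; split.
  split=> //; last by rewrite s'3.
  by move: inp; rewrite /input /=; case: (0 < _).
split.
- by move=> u; rewrite ltnS leq_eqVlt ex3; case: eqVneq => [->|_] //= /sex.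
- by move=> u; rewrite lab4.
- move=> u v uN vN; rewrite res5 // ltnS leq_eqVlt.
  by case: eqVneq => [->|_] //=; exact: sres.
Qed.

Definition nodes_time (m l : nat) : nat :=
  for_time (Var 1) l (for_time (Var 0) m (run_time node_cmd)).

Lemma nodesP m l a lam mem s :
  built m l a lam mem m s -> vars s 6 = m ->
  wp (For 4 (Var 1) (For 5 (Var 0) node_cmd)) (nodes_time m l)
    (built m l a lam mem (l.+1 * m)) s.
Proof.
move=> bs s6.
pose I k s' := built m l a lam mem (k.+1 * m) s' /\ vars s' 6 = (k.+1 * m)%N.
apply: (@wp_for _ _ _ l _ I).
- by move=> k s' [[[[]]]].
- move=> k s1 kl [b1 s16] s1k.
  pose J r s' := [/\ built m l a lam mem (k.+1 * m + r) s', vars s' 4 = k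
                   & vars s' 6 = (k.+1 * m + r)%N].
  apply: (@wp_for _ _ _ m _ J).
  + by move=> r s' [[[[]]]].
  + move=> r s2 rm [b2 s24 s26] s2r; apply: wp_run => //.
    have [b3 s34 s35 s36] := node_cmdP kl rm b2 s24 s2r s26.
    by split=> //; rewrite /J addnS.
  + by rewrite /J addn0.
  + by move=> s' [b' s'4 s'6]; rewrite /I mulSn addnC.
- by rewrite /I mul1n.
- by move=> s' [].
Qed.

Definition build_time (m l : nat) : nat := (6 + (rows_time m + (2 + nodes_time m l)))%N.

Lemma buildP m l a lam mem s :
  input m l a lam mem s -> vars s 3 = 0 ->
  (forall b, (2 < b)%N -> arrs s b = fun=> 0) ->
  wp build_cmd (build_time m l) (built m l a lam mem (l.+1 * m)) s.
Proof.
move=> inp s3 arr0; have [sm sl _ _ _] := inp.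
apply/wp_seq/wp_assign/wp_seq.
have sN : vars (set_var s 2 ((vars s 1 + 1) * vars s 0)) 2 = (l.+1 * m)%N.
  by rewrite /= sm sl; lia.
have inpN : input m l a lam mem (set_var s 2 ((vars s 1 + 1) * vars s 0)).
  by case: inp => *; split.
apply: wp_mono (leqnn _) _ (rowsP inpN sN s3 arr0) => s1 b1.
apply/wp_seq/wp_assign/nodesP => //.
by have [[[s1m _ _ _ _] _ _] _] := b1; rewrite /= s1m.
Qed.

Definition membership_cmd : cmd :=
  Seq build_cmd
  (Seq (For 7 phases_expr (For 8 vN discharge_cmd))
  (Seq (Assign 0 (Const 1)) (For 8 vN verdict_cmd))).

Definition membership_time (m l : nat) : nat :=
  (build_time m l + (flow_time (l.+1 * m) + (2 + verdict_time (l.+1 * m))))%N.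

Lemma membership_cmdP m l a lam mem s :
  input m l a lam mem s -> vars s 3 = 0 ->
  (forall b, (2 < b)%N -> arrs s b = fun=> 0) ->
  wp membership_cmd (membership_time m l)
    (fun s' => vars s' 0 = (nat_of_bool `[< forall X,
        net_supply (l.+1 * m) (network m a lam mem (\sum_(i < m) a i)) X <= 0 >])%:Z) s.
Proof.
move=> inp s3 arr0; apply: wp_seq.
apply: wp_mono (leqnn _) _ (buildP inp s3 arr0) => s1 [[_ s1N _] [s1ex s1lab s1res]].
set N := (l.+1 * m)%N in s1N s1ex s1res *; set g := network _ _ _ _ _ in s1ex s1res *.
have hold1 : holds N g s1.
  by split=> // u v uN vN; rewrite s1res // vN.
apply: wp_seq; apply: wp_mono (leqnn _) _ (flowP hold1 (valid_network _ _ _ _ _ _) _) => // s2.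
move=> [g2 [hold2 val2 W2 stalled]].
apply/wp_seq/wp_assign.
have hold3 : holds N g2 (set_var s2 0 1) by exact: holds_set_var.
apply: wp_mono (leqnn _) _ (verdictP hold3 _) => // s3' ->.
(* Pushes and relabelings preserve the net supply, so the cut condition of the initial network is
   read off the final excesses. *)
congr (Posz (nat_of_bool _)); apply/forallP/asboolP.
  move=> ex_le0 X; rewrite -W2; move: X; apply/(stalled_preflowP val2 stalled) => u uN.
  exact: (ex_le0 (Ordinal uN)).
move=> cut u; apply: (proj1 (stalled_preflowP val2 stalled)) => // X.
by rewrite W2.
Qed.

(** * Input encoding and polynomial time bounds *)

Lemma nth_allpairs (S T : Type) (f : S -> T -> nat) (xs : seq S) (ys : seq T) (x0 : S) (y0 : T)
    (i j : nat) : (i < size xs)%N -> (j < size ys)%N ->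
  nth 0%N [seq f x y | x <- xs, y <- ys] (i * size ys + j) = f (nth x0 xs i) (nth y0 ys j).
Proof.
elim: xs i => [|x xs IHxs] [|i] //= lti ltj; rewrite nth_cat size_map.
  by rewrite mul0n add0n ltj (nth_map y0).
by rewrite ifF ?mulSn -?addnA ?addKn ?IHxs //; lia.
Qed.

Lemma input_encode m l (Rk : 'I_l -> {set 'I_m}) (lam : 'I_l -> nat) (a : m.-tuple nat) :
  input m l (nth 0%N a) (nth 0%N [seq lam k | k <- enum 'I_l])
    (nth 0%N [seq nat_of_bool (r \in Rk k) | k <- enum 'I_l, r <- enum 'I_m])
    (encode Rk lam a).
Proof. by split. Qed.

(** Equality with a polynomial rather than a bound: the budgets are built from constants, [m] and
    [l] by sums and products. *)
Definition poly_time (f : nat -> nat -> nat) : Prop :=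
  exists p : {poly {poly nat}}, forall m l, f m l = p.[m, l].

Lemma poly_time_const (c : nat) : poly_time (fun _ _ => c).
Proof. by exists c%:P%:P => m l; rewrite !hornerC. Qed.

Lemma poly_time_fst : poly_time (fun m _ => m).
Proof. by exists 'X => m l; rewrite hornerX hornerC. Qed.

Lemma poly_time_snd : poly_time (fun _ l => l).
Proof. by exists ('X%:P) => m l; rewrite hornerC hornerX. Qed.

Lemma poly_time_add f g : poly_time f -> poly_time g -> poly_time (fun m l => f m l + g m l)%N.
Proof. by move=> [p pE] [q qE]; exists (p + q) => m l; rewrite !hornerD pE qE. Qed.

Lemma poly_time_mul f g : poly_time f -> poly_time g -> poly_time (fun m l => f m l * g m l)%N.
Proof. by move=> [p pE] [q qE]; exists (p * q) => m l; rewrite !hornerM pE qE. Qed.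

Lemma poly_time_succ f : poly_time f -> poly_time (fun m l => (f m l).+1).
Proof. by move=> [p pE]; exists (p + 1) => m l; rewrite !hornerD !hornerC pE -addn1. Qed.

Ltac solve_poly_time :=
  do ![assumption | apply: poly_time_const | apply: poly_time_fst
      | apply: poly_time_snd | apply: poly_time_succ | apply: poly_time_add
      | apply: poly_time_mul].

Lemma poly_time_for e f g : poly_time f -> poly_time g ->
  poly_time (fun m l => for_time e (f m l) (g m l)).
Proof. by move=> pf pg; rewrite /for_time; solve_poly_time. Qed.

Lemma poly_time_membership : poly_time membership_time.
Proof.
have pN : poly_time (fun m l => l.+1 * m)%N by solve_poly_time.
have pscan : poly_time (fun m l => discharge_time (l.+1 * m)).
  by rewrite /discharge_time; solve_poly_time; apply: poly_time_for => //; solve_poly_time.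
have pflow : poly_time (fun m l => flow_time (l.+1 * m)).
  apply: poly_time_for; first by rewrite /phases; solve_poly_time.
  exact: poly_time_for.
have pverdict : poly_time (fun m l => verdict_time (l.+1 * m)).
  by apply: poly_time_for => //; solve_poly_time.
have prows : poly_time (fun m l => rows_time m) by apply: poly_time_for; solve_poly_time.
have pnodes : poly_time (fun m l => nodes_time m l).
  by apply: poly_time_for; [|apply: poly_time_for]; solve_poly_time.
by rewrite /membership_time /build_time; solve_poly_time.
Qed.

Theorem theorem2p35 (R : realType) :
  exists (prog : cmd) (p : {poly {poly nat}}),
  forall (n : nat) (D : {set 'I_n * 'I_n}) (C : compression D)
    (a : (cm C).-tuple nat),
    (\sum_(i < cm C) tnth a i)%N = #|D| ->
    exists (t : nat) (s : state),
      [/\ exec prog (encode (crows C) (cmult C) a) t s,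
          (t <= p.[cm C, cl C])%N
        & answers s (schubitope R D (pad_zeros R n a))].
Proof.
have [p pE] := poly_time_membership.
exists membership_cmd, p => n D C a sumD.
have [|b b_gt2|t [s [ex le ans]]] := membership_cmdP (input_encode (crows C) (cmult C) a).
- by [].
- by case: b b_gt2 => [|[|[|]]].
exists t, s; split=> //; first by rewrite -pE.
rewrite /answers ans; congr (Posz (nat_of_bool _)); apply: asbool_equiv_eq.
(* Membership becomes the inequalities for all [S], and these become the cut condition that the
   program decides. *)
rewrite (schubitopeP R (cm_le C) sumD); apply: theta_le_cuts => [k|k r].
  by rewrite (nth_map k) ?size_enum_ord // nth_ord_enum.
have := @nth_allpairs _ _ (fun k r => nat_of_bool (r \in crows C k))
  (enum 'I_(cl C)) (enum 'I_(cm C)) k r k r.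
rewrite !size_enum_ord => -> //.
by rewrite !nth_ord_enum !inE.
Qed.
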